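(* In the dual service range model, as $n\to\infty$ with the parameters fixed: (i) If $r=0$ (with $b\ge0$, $p\in(0,1)$), the expected size of a maximum matching satisfies $$\frac1n\,\nu_n(0,b,p)=\frac{e^{2pb}-e^{2b}}{e^{2pb}-\frac1p e^{2b}}+o(1).$$ (ii) If $b=0$ or $p=0$, the expected size of a maximum matching satisfies $$\frac1n\,\nu_n(r,0,p)=\frac{r}{r+1/2}+o(1)\quad\text{and}\quad \frac1n\,\nu_n(r,b,0)=\frac{r}{r+1/2}+o(1).$$
   Context: Dual service range model with parameters $r,b\ge0$ and $p\in[0,1]$: $n$ supply locations $s_1,\dots,s_n$ and $n$ demand locations $d_1,\dots,d_n$ are i.i.d. uniform on $[0,1]$. A fraction $p$ of the supply nodes ($pn$ of them, rounded to an integer) are flexible, with service range $r_i=r+b$; the others are inflexible, with service range $r_i=r$. Supply $i$ and demand $j$ are adjacent in the bipartite graph $G$ iff $|s_i-d_j|\le r_i/n$. $\nu_n(r,b,p)$ is the expected size of a maximum matching of $G$. *)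

(* Defs.v *)
From HB Require Import structures.
From mathcomp Require Import all_boot all_order all_algebra.
From mathcomp Require Import all_classical all_reals all_analysis.

Set Implicit Arguments.
Unset Strict Implicit.
Unset Printing Implicit Defensive.

Import Order.TTheory GRing.Theory Num.Theory.
Import numFieldNormedType.Exports.

Local Open Scope classical_set_scope.
Local Open Scope ring_scope.

Section Probability.
Context (d : measure_display) (T : measurableType d) (R : realType).
Variable P : probability T R.

Definition mutually_independent (I : finType) (X : I -> {RV P >-> R}) : Prop :=
  forall (J : {set I}) (A : I -> set R),
    (forall i, i \in J -> measurable (A i)) ->
    P (\bigcap_(i in [set` J]) (X i @^-1` A i))
    = (\prod_(i in J) P (X i @^-1` A i))%E.

Definition uniform01 (X : {RV P >-> R}) : Prop :=
  forall A : set R, measurable A ->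
    distribution P X A = uniform_prob (@ltr01 R) A.

(* The 2n locations are jointly independent, not just within each side. *)
Definition iid_uniform_locations (n : nat) (s t : 'I_n -> {RV P >-> R}) : Prop :=
  let X (v : 'I_n + 'I_n) := match v with inl i => s i | inr j => t j end in
  mutually_independent X /\ forall v, uniform01 (X v).

End Probability.

Section Matching.
Variables (U V : finType) (e : U -> V -> bool).

Definition is_matching (M : {set U * V}) : bool :=
  [forall x in M, e x.1 x.2] &&
  [forall x in M, forall y in M, (x.1 == y.1) || (x.2 == y.2) ==> (x == y)].

Definition max_matching_size : nat :=
  (\max_(M : {set U * V} | is_matching M) #|M|)%N.

End Matching.

Section DualServiceRange.
Variable R : realType.

Definition service_range (n : nat) (r b : R) (F : {set 'I_n}) (i : 'I_n) : R :=
  if i \in F then r + b else r.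

Definition service_graph (n : nat) (r b : R) (F : {set 'I_n})
    (x y : 'I_n -> R) (i j : 'I_n) : bool :=
  `|x i - y j| <= service_range r b F i / n%:R.

(* #|F n| may be p * n rounded to an integer in any way (down, up, nearest). *)
Definition flexible_fraction (p : R) (F : forall n, {set 'I_n}) : Prop :=
  forall n, `| #|F n|%:R - p * n%:R | < 1.

Definition expected_matching_size (d : measure_display) (T : measurableType d)
    (P : probability T R) (n : nat) (s t : 'I_n -> {RV P >-> R})
    (r b : R) (F : {set 'I_n}) : \bar R :=
  ('E_P[fun w => (max_matching_size
          (service_graph r b F (fun i => s i w) (fun j => t j w)))%:R])%E.

End DualServiceRange.

(* Main.v *)
Require Import Defs.
From HB Require Import structures.
From mathcomp Require Import all_boot all_order all_algebra all_fingroup.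
From mathcomp Require Import all_classical all_reals all_analysis.
From mathcomp Require Import measurable_realfun.
From mathcomp Require Import zify ring lra.

(* Only the k ~ p n suppliers with positive range matter: an inflexible supplier of range 0
   almost surely matches nobody, and in (ii) all n suppliers have the same range. So let k
   suppliers of range a / n face n demands. Cut [0, 1] into N = n m cells; distances are then
   known up to one cell, and for m large few cells contain two points. Symmetrizing over
   permutations of the cells replaces the n + n uniform points by independent Bernoulli cells
   (probabilities p / m and 1 / m), because the maximum matching size is 1-Lipschitz in each of
   the two sets of occupied cells and these sets concentrate around sizes k and n.

   For Bernoulli cells a greedy left-to-right matching is optimal. With radius L ~ a m cells, its
   state is one integer w in [0, 2 L]: w + 1 unrevealed demand cells are within reach of the next
   supply cell. If that cell is empty, w becomes w + 1, capped at 2 L; if it is occupied, the first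
   occupied demand cell is the G-th unrevealed one with G geometric, and either G <= w + 1, which
   is a match and w becomes w + 1 - G, or the supplier is lost and w becomes 0. The Poisson
   equation of this Markov chain is solved explicitly by geometric sums, so the mean number of
   matches is N c + O(1) with c explicit. Finally n -> oo for fixed m, and then m -> oo. *)

Set Implicit Arguments.
Unset Strict Implicit.
Unset Printing Implicit Defensive.

Import Order.TTheory GRing.Theory Num.Theory.
Import numFieldNormedType.Exports.

Local Open Scope ring_scope.

(** * Matchings as sequences of edges *)

(** Edge lists over any [eqType] let finite graphs and strips on [nat] be treated alike, with edges
    freely removed or relabelled. *)
Definition seq_matching (U V : eqType) (e : U -> V -> bool) (s : seq (U * V)) :=
  [&& uniq (unzip1 s), uniq (unzip2 s) & all (fun x => e x.1 x.2) s].

Lemma seq_matching_perm (U V : eqType) (e : U -> V -> bool) s s' :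
  perm_eq s s' -> seq_matching e s = seq_matching e s'.
Proof.
move=> ss'; rewrite /seq_matching (perm_uniq (perm_map _ ss')).
by rewrite (perm_uniq (perm_map _ ss')) (perm_all _ ss').
Qed.

Lemma seq_matching_filter (U V : eqType) (e : U -> V -> bool) a s :
  seq_matching e s -> seq_matching e (seq.filter a s).
Proof.
case/and3P=> u1 u2 es; apply/and3P; split.
- by apply: subseq_uniq u1; apply/map_subseq/filter_subseq.
- by apply: subseq_uniq u2; apply/map_subseq/filter_subseq.
- rewrite all_filter; apply: sub_all es => x /= ->; exact: implybT.
Qed.

Lemma seq_matching_map (U V U' V' : eqType) (e : U -> V -> bool)
    (e' : U' -> V' -> bool) (f : U -> U') (g : V -> V') s :
  seq_matching e s ->
  {in unzip1 s &, injective f} -> {in unzip2 s &, injective g} ->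
  {in s, forall x, e x.1 x.2 -> e' (f x.1) (g x.2)} ->
  seq_matching e' [seq (f x.1, g x.2) | x <- s].
Proof.
case/and3P=> u1 u2 es fi gi ee'; apply/and3P; split.
- by rewrite /unzip1 -map_comp (map_comp f fst) map_inj_in_uniq.
- by rewrite /unzip2 -map_comp (map_comp g snd) map_inj_in_uniq.
- rewrite all_map; apply/allP => x xs /=.
  by apply: ee' => //; exact: (allP es).
Qed.

Lemma uniq_map_inj (U V : eqType) (f : U -> V) (s : seq U) :
  uniq (map f s) -> {in s &, injective f}.
Proof.
case: s => [//|x0 s'] fu x y; set s := x0 :: s' => xs ys fxy.
have /(uniqP (f x0)) inj := fu.
have ij : index x s = index y s.
  by apply: inj; rewrite ?inE ?size_map ?index_mem // !(nth_map x0) ?index_mem // !nth_index.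
by rewrite -(nth_index x0 xs) ij nth_index.
Qed.

Lemma seq_matching_size (U V : finType) (e : U -> V -> bool) s :
  seq_matching e s -> (size s <= max_matching_size e)%N.
Proof.
case/and3P=> u1 u2 es.
have us : uniq s by exact: map_uniq u1.
have inj1 : {in s &, injective fst} by exact: uniq_map_inj u1.
have inj2 : {in s &, injective snd} by exact: uniq_map_inj u2.
rewrite -(card_uniqP us) -cardsE.
apply: (@leq_bigmax_cond _ (@is_matching U V e) (fun M => #|M|) (finset (mem s))).
apply/andP; split.
  by apply/forall_inP => x; rewrite inE => xs; exact: (allP es).
apply/forall_inP => x; rewrite inE => xs; apply/forall_inP => y; rewrite inE => ys.
by apply/implyP => /orP[/eqP/inj1|/eqP/inj2] -> //.
Qed.

Lemma max_seq_matching (U V : finType) (e : U -> V -> bool) :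
  exists2 s, seq_matching e s & size s = max_matching_size e.
Proof.
have [|M Mm MM] := @eq_bigmax_cond _ (@is_matching U V e) (fun M => #|M|).
  apply/card_gt0P; exists finset.set0; rewrite unfold_in /is_matching.
  by apply/andP; split; apply/forall_inP => x; rewrite inE.
exists (enum M); last by rewrite -cardE -MM.
move: Mm; rewrite unfold_in => /andP[/forall_inP Me /forall_inP Mi].
have Mi' x y : x \in M -> y \in M -> (x.1 == y.1) || (x.2 == y.2) -> x = y.
  by move=> xM yM h; apply/eqP; move: (Mi x xM) => /forall_inP/(_ y yM)/implyP; exact.
apply/and3P; split.
- rewrite map_inj_in_uniq ?enum_uniq // => x y.
  by rewrite !mem_enum => xM yM xy; apply: Mi'; rewrite // xy eqxx.
- rewrite map_inj_in_uniq ?enum_uniq // => x y.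
  by rewrite !mem_enum => xM yM xy; apply: Mi'; rewrite // xy eqxx orbT.
- by apply/allP => x; rewrite mem_enum; exact: Me.
Qed.

(** Each discarded edge is charged to an endpoint violating [P] or [Q]; edges of a matching share no
    endpoint, so no vertex is charged twice. *)
Lemma seq_matching_size_good (U V : finType) (e : U -> V -> bool)
    (P : pred U) (Q : pred V) s : seq_matching e s ->
  (size s <= size [seq x <- s | P x.1 && Q x.2]
             + (#|[predC P]| + #|[predC Q]|))%N.
Proof.
case/and3P=> u1 u2 _.
rewrite -(count_predC (fun x => P x.1 && Q x.2) s) size_filter leq_add2l.
have -> : count (predC (fun x => P x.1 && Q x.2)) s =
   count (fun x => predC P x.1 || predC Q x.2) s.
  by apply: eq_count => x /=; rewrite negb_and.
have h : (count (fun x : U * V => predC P x.1 || predC Q x.2) s <=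
   count (fun x => predC P x.1) s + count (fun x => predC Q x.2) s)%N.
  by rewrite -count_predUI leq_addr.
apply: leq_trans h _; apply: leq_add.
- rewrite -(count_map fst) -size_filter -(card_uniqP (filter_uniq _ u1)).
  by apply: subset_leq_card; apply/fintype.subsetP => x; rewrite mem_filter => /andP[].
- rewrite -(count_map snd) -size_filter -(card_uniqP (filter_uniq _ u2)).
  by apply: subset_leq_card; apply/fintype.subsetP => x; rewrite mem_filter => /andP[].
Qed.

(** * Optimality of the greedy matching on a line *)

Section Greedy.
Variable L : nat.

(* Supply cell [i] reaches demand cells [i + w - 2 L .. i + w]. *)
Definition strip (as_ bs : seq bool) (w : nat) (i j : nat) : bool :=
  [&& nth false as_ i, nth false bs j, j <= i + w & i + w <= j + L.*2]%N.

(** Search for a partner of the current supplier: the head of [bs] is its leftmost unrevealed demand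
    cell, [w] further ones are in reach, and [H] continues with the next supplier. An empty cell at
    [w = 0] loses the supplier; the next one then has exactly one cell in reach, hence state 0. *)
Fixpoint scan (H : seq bool -> nat -> nat) (bs : seq bool) (w : nat) : nat :=
  match bs, w with
  | [::], _ => 0
  | true :: bs', _ => (H bs' w).+1
  | false :: bs', 0 => H bs' 0
  | false :: bs', w'.+1 => scan H bs' w'
  end%N.

(** At an empty supply cell the window grows by one demand cell; at the cap [2 L] its leftmost cell
    drops out of reach instead, hence [behead]. *)
Fixpoint greedy (as_ bs : seq bool) (w : nat) : nat :=
  match as_ with
  | [::] => 0
  | true :: as' => scan (greedy as') bs w
  | false :: as' => if w < L.*2 then greedy as' bs w.+1
                    else greedy as' (behead bs) w
  end%N.

(** The booleans [a], [b] coerce to shifts by 0 or 1: the first supply cell, the first demand cell,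
    or both are deleted. *)
Lemma seq_matching_pred (e e' : nat -> nat -> bool) s (a b : bool) :
  seq_matching e s ->
  (forall i j, (i, j) \in s -> e i j ->
     [/\ a <= i, b <= j & e' (i - a) (j - b)]%N) ->
  seq_matching e' [seq ((x.1 - a)%N, (x.2 - b)%N) | x <- s].
Proof.
move=> sm ee'; have /and3P[_ _ /allP es] := sm.
apply: (seq_matching_map (f := fun i => (i - a)%N) (g := fun j => (j - b)%N) sm).
- move=> i i' /mapP[x xs ->] /mapP[y ys ->].
  case: x y xs ys => [i1 j1] [i2 j2] /= xs ys.
  have [/= + _ _] := ee' _ _ xs (es _ xs); have [/= + _ _] := ee' _ _ ys (es _ ys).
  by lia.
- move=> i i' /mapP[x xs ->] /mapP[y ys ->].
  case: x y xs ys => [i1 j1] [i2 j2] /= xs ys.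
  have [/= _ + _] := ee' _ _ xs (es _ xs); have [/= _ + _] := ee' _ _ ys (es _ ys).
  by lia.
- by move=> [i j] xs /= eij; have [] := ee' _ _ xs eij.
Qed.

Lemma seq_matching_succ (e e' : nat -> nat -> bool) s (a b : bool) :
  seq_matching e' s ->
  (forall i j, e' i j -> e (i + a) (j + b))%N ->
  seq_matching e [seq ((x.1 + a)%N, (x.2 + b)%N) | x <- s].
Proof.
move=> sm ee'; apply: (seq_matching_map (f := addn^~ a) (g := addn^~ b) sm).
- by move=> i i' _ _ /addIn.
- by move=> i i' _ _ /addIn.
- by move=> x _; exact: ee'.
Qed.

(* An exchange turns a matching using (0, j) and (i, 0) into one using (0, 0) and (i, j). *)
Lemma strip_exchange as_ bs w s : (w <= L.*2)%N ->
  seq_matching (strip (true :: as_) (true :: bs) w) s ->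
  exists2 s', seq_matching (strip as_ bs w) s' & (size s <= (size s').+1)%N.
Proof.
move=> wL.
set e := strip (true :: as_) (true :: bs) w => sm.
(* A matching that avoids both first cells lives on the tails. *)
have down t : seq_matching e t -> all (fun x => (0 < x.1) && (0 < x.2))%N t ->
    exists2 s', seq_matching (strip as_ bs w) s' & size t = size s'.
  move=> tm /allP t0.
  exists [seq ((x.1 - true)%N, (x.2 - true)%N) | x <- t]; last by rewrite size_map.
  apply: (seq_matching_pred tm) => i j /t0/= /andP[i0 j0].
  rewrite /e /strip; case: i i0 => // i _; case: j j0 => // j _ /=.
  by rewrite !subn1 /= => /and4P[-> ->] h1 h2; split=> //=; clear -wL h1 h2; lia.
have [/mapP[[z j] /= zs z0]|n0] := boolP (0%N \in unzip1 s); last first.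
  have [/mapP[[i z] /= zs z0]|m0] := boolP (0%N \in unzip2 s); last first.
    have [|s' s'm ss'] := down s sm.
      apply/allP => -[i j] ijs /=; rewrite !lt0n; apply/andP; split.
        by apply: contraNneq n0 => i0; apply/mapP; exists (i, j).
      by apply: contraNneq m0 => j0; apply/mapP; exists (i, j).
    by exists s'; rewrite // ss'.
  subst z.
  have sp := perm_to_rem zs; have := sm; rewrite (seq_matching_perm _ sp) => sm'.
  have /and3P[/= /andP[_ u1] /andP[nz u2] /andP[_ es]] := sm'.
  have rm : seq_matching e (rem (i, 0%N) s) by exact/and3P.
  have [|s' s'm ss'] := down _ rm.
    apply/allP => -[i' j] ijs /=; rewrite !lt0n; apply/andP; split.
      by apply: contraNneq n0 => i0; apply/mapP; exists (i', j) => //; exact: mem_rem ijs.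
    by apply: contraNneq nz => j0; apply/mapP; exists (i', j).
  by exists s'; rewrite // (perm_size sp) /= ss'.
subst z.
have sp := perm_to_rem zs; have := sm; rewrite (seq_matching_perm _ sp) => sm'.
have /and3P[/= /andP[nz1 u1] /andP[nz2 u2] /andP[e0j es]] := sm'.
move: nz1 nz2 u1 u2 es sp sm'; set t := rem _ _ => nz1 nz2 u1 u2 es sp sm'.
have [/mapP[[i z] /= zt z0]|m0] := boolP (0%N \in unzip2 t); last first.
  have tm : seq_matching e t by exact/and3P.
  have [|s' s'm ss'] := down _ tm.
    apply/allP => -[i' j'] ijs /=; rewrite !lt0n; apply/andP; split.
      by apply: contraNneq nz1 => i0; apply/mapP; exists (i', j').
    by apply: contraNneq m0 => j0; apply/mapP; exists (i', j').
  by exists s'; rewrite // (perm_size sp) /= ss'.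
subst z.
have tp := perm_to_rem zt.
have i0 : i != 0%N by apply: contraNneq nz1 => i0; apply/mapP; exists (i, 0%N).
have j0 : j != 0%N by apply: contraNneq nz2 => ->; apply/mapP; exists (i, 0%N).
have ei0 : e i 0%N by exact: (allP es _ zt).
have tm : seq_matching e t by exact/and3P.
move: (tm); rewrite (seq_matching_perm _ tp).
case/and3P => /= /andP[ni v1] /andP[n0 v2] /andP[_ es'].
(* [(i, j)] is an edge: [(0, j)] gives [j <= w], and [(i, 0)] gives [i + w <= 2 L]. *)
have rm : seq_matching e ((i, j) :: rem (i, 0%N) t).
  apply/and3P; split=> /=.
  - by rewrite ni.
  - rewrite v2 andbT; apply: contraNN nz2 => /mapP[x xt ->].
    by apply/mapP; exists x => //; exact: mem_rem xt.
  - rewrite es' andbT; move: e0j ei0; rewrite /e /strip => /and4P[_ -> h1 h2].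
    move=> /and4P[-> _ h3 h4] /=; clear -wL h1 h2 h3 h4 i0 j0.
    by apply/andP; split; lia.
have [|s' s'm ss'] := down _ rm.
  rewrite /= !lt0n i0 j0 /=; apply/allP => -[i' j'] ijs /=; rewrite !lt0n.
  apply/andP; split.
    by apply: contraNneq nz1 => i'0; apply/mapP; exists (i', j') => //; exact: mem_rem ijs.
  by apply: contraNneq n0 => j'0; apply/mapP; exists (i', j').
exists s' => //; rewrite (perm_size sp) /= (perm_size tp) /=.
by rewrite -ss' /=.
Qed.

(** Induction along the run of [greedy]. A deleted cell that is empty, or whose reachable cells are
    all empty or already deleted, carries no edge; two occupied first cells are removed by
    [strip_exchange] at the cost of one edge. *)
Lemma strip_le_greedy as_ bs w s : (w <= L.*2)%N ->
  seq_matching (strip as_ bs w) s -> (size s <= greedy as_ bs w)%N.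
Proof.
elim: as_ bs w s => [|a as_ IH] bs w s wL sm.
  case: s sm => [//|[i j] s] /and3P[_ _ /= /andP[]].
  by rewrite /strip nth_nil.
case: a sm => sm /=.
  elim: bs w s wL sm => [|b bs IHb] w s wL sm.
    case: s sm => [//|[i j] s] /and3P[_ _ /= /andP[]].
    by rewrite /strip nth_nil andbF.
  case: b sm => sm.
    have [s' s'm ss'] := strip_exchange wL sm.
    by apply: leq_trans ss' _; rewrite /= ltnS; exact: IH.
  case: w wL sm => [|w] wL sm.
    rewrite /= -(size_map (fun x => ((x.1 - true)%N, (x.2 - true)%N))).
    apply: (IH _ _ _ wL); apply: (seq_matching_pred sm) => i j _.
    rewrite /strip; case: j => [|j] /=; first by rewrite andbF.
    case: i => [|i] /=; first by rewrite andbF.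
    by rewrite !subn1 /= => /and4P[-> ->] h1 h2; split=> //; clear -wL h1 h2; lia.
  rewrite /= -(size_map (fun x => ((x.1 - false)%N, (x.2 - true)%N))).
  apply: (IHb w); first by lia.
  apply: (seq_matching_pred sm) => i j _.
  rewrite /strip; case: j => [|j] /=; first by rewrite andbF.
  by rewrite !subn1 !subn0 /= => /and4P[-> ->] h1 h2; split=> //; clear -wL h1 h2; lia.
case: ifP => wL'.
  rewrite /= -(size_map (fun x => ((x.1 - true)%N, (x.2 - false)%N))).
  apply: (IH _ _ _ wL'); apply: (seq_matching_pred sm) => i j _.
  rewrite /strip; case: i => [|i] //=.
  by rewrite !subn1 !subn0 /= => /and4P[-> ->] h1 h2; split=> //; clear -wL h1 h2; lia.
rewrite /= -(size_map (fun x => ((x.1 - true)%N, (x.2 - true)%N))).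
apply: (IH _ _ _ wL); apply: (seq_matching_pred sm) => i j _.
rewrite /strip; case: i => [|i] //=.
case: j => [|j]; first by move=> /and4P[_ _ _ h]; clear -h wL'; lia.
by rewrite !subn1 nth_behead /= => /and4P[-> ->] h1 h2; split=> //; clear -wL h1 h2; lia.
Qed.

(** The pairs found along the run, shifted back by the deleted cells, form a matching. *)
Lemma greedy_matching as_ bs w : (w <= L.*2)%N ->
  exists2 s, seq_matching (strip as_ bs w) s & size s = greedy as_ bs w.
Proof.
elim: as_ bs w => [|a as_ IH] bs w wL; first by exists [::].
case: a => /=.
  elim: bs w wL => [|b bs IHb] w wL; first by exists [::].
  case: b.
    have [s sm ss] := IH bs w wL.
    exists ((0%N, 0%N) :: [seq ((x.1 + true)%N, (x.2 + true)%N) | x <- s]);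
      last by rewrite /= size_map ss.
    have /and3P[u1 u2 es] :
        seq_matching (strip (true :: as_) (true :: bs) w)
          [seq ((x.1 + true)%N, (x.2 + true)%N) | x <- s].
      apply: (seq_matching_succ sm) => i j; rewrite /strip !addn1 /=.
      by move=> /and4P[-> ->] /= h1 h2; clear -wL h1 h2; lia.
    apply/and3P; split=> /=.
    + by rewrite u1 andbT; apply/mapP => -[x /mapP[y _ ->]] /=; lia.
    + by rewrite u2 andbT; apply/mapP => -[x /mapP[y _ ->]] /=; lia.
    + by rewrite es andbT /strip /=; lia.
  case: w wL => [|w] wL.
    have [s sm ss] := IH bs 0%N wL.
    exists [seq ((x.1 + true)%N, (x.2 + true)%N) | x <- s];
      last by rewrite /= size_map ss.
    apply: (seq_matching_succ sm) => i j; rewrite /strip !addn1 /=.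
    by move=> /and4P[-> ->] /= h1 h2; clear -wL h1 h2; lia.
  have [|s sm ss] := IHb w; first by lia.
  exists [seq ((x.1 + false)%N, (x.2 + true)%N) | x <- s];
    last by rewrite /= size_map ss.
  apply: (seq_matching_succ sm) => i j; rewrite /strip !addn1 !addn0 /=.
  by move=> /and4P[-> ->] /= h1 h2; clear -wL h1 h2; lia.
case: ifP => wL'.
  have [s sm ss] := IH bs w.+1 wL'.
  exists [seq ((x.1 + true)%N, (x.2 + false)%N) | x <- s];
    last by rewrite /= size_map ss.
  apply: (seq_matching_succ sm) => i j; rewrite /strip !addn1 !addn0 /=.
  by move=> /and4P[-> ->] /= h1 h2; clear -wL h1 h2; lia.
have [s sm ss] := IH (behead bs) w wL.
exists [seq ((x.1 + true)%N, (x.2 + true)%N) | x <- s];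
  last by rewrite /= size_map ss.
apply: (seq_matching_succ sm) => i j; rewrite /strip !addn1 nth_behead /=.
by move=> /and4P[-> ->] /= h1 h2; clear -wL h1 h2; lia.
Qed.

End Greedy.

(** * Mean of the greedy matching on Bernoulli cells *)

Section Bernoulli.
Variable R : realFieldType.
Implicit Types (p a b c x : R) (F G : seq bool -> R).

(** Expectation over [N] independent Bernoulli([p]) bits, by conditioning on the first bit: the same
    recursion that [greedy] follows. *)
Fixpoint bern p (N : nat) F : R :=
  if N is N'.+1 then p * bern p N' (fun s => F (true :: s)) +
                     (1 - p) * bern p N' (fun s => F (false :: s))
  else F [::].

Lemma eq_bern p N F G :
  (forall s, size s = N -> F s = G s) -> bern p N F = bern p N G.
Proof.
elim: N F G => [|N IH] F G FG /=; first exact: FG.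
by congr (_ * _ + _ * _); apply: IH => s sN; apply: FG; rewrite /= sN.
Qed.

Lemma bern_lin p N a b F G :
  bern p N (fun s => a * F s + b * G s) = a * bern p N F + b * bern p N G.
Proof.
elim: N F G => [//|N IH] F G /=.
by rewrite (IH (fun s => F _)) (IH (fun s => F (false :: s))); ring.
Qed.

Lemma bern_cst p N a : bern p N (fun=> a) = a.
Proof. by elim: N => [//|N IH] /=; rewrite IH; ring. Qed.

Lemma bernS p N a F : bern p N (fun s => a + F s) = a + bern p N F.
Proof.
have := bern_lin p N 1 1 (fun=> a) F; rewrite bern_cst !mul1r => <-.
by apply: eq_bern => s _; rewrite !mul1r.
Qed.

Lemma bern_le p N F G : 0 <= p <= 1 ->
  (forall s, size s = N -> F s <= G s) -> bern p N F <= bern p N G.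
Proof.
move=> /andP[p0 p1]; elim: N F G => [|N IH] F G FG /=; first exact: FG.
by apply: lerD; apply: ler_wpM2l; rewrite ?subr_ge0 //; apply: IH => s sN;
  apply: FG; rewrite /= sN.
Qed.

Lemma bern_take p N L F : (forall s, F s = F (take N s)) ->
  bern p (N + L) F = bern p N F.
Proof.
elim: N F => [|N IH] F FE.
  by rewrite -[RHS](bern_cst p L); apply: eq_bern => s _; rewrite FE take0.
by rewrite /=; congr (_ * _ + _ * _); apply: IH => s; rewrite FE.
Qed.

Lemma bern_behead p N F :
  bern p N.+1 (fun s => F (behead s)) = bern p N F.
Proof. by rewrite /=; ring. Qed.

Lemma bern_moment2 p N x :
  bern p N (fun s => ((count id s)%:R - x) ^+ 2)
  = N%:R * p * (1 - p) + (N%:R * p - x) ^+ 2.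
Proof.
elim: N x => [|N IH] x; first by rewrite /=; ring.
have -> : bern p N.+1 (fun s => ((count id s)%:R - x) ^+ 2) =
   p * bern p N (fun s => ((count id s)%:R - (x - 1)) ^+ 2) +
   (1 - p) * bern p N (fun s => ((count id s)%:R - x) ^+ 2).
  rewrite /=; congr (_ * _ + _ * _); apply: eq_bern => s _ /=.
    by rewrite natrD; congr (_ ^+ 2); ring.
by rewrite !IH -[in RHS]natr1; ring.
Qed.

Section GreedyDrift.
Variables (al be : R) (L : nat).
Hypotheses (al01 : 0 <= al <= 1) (be01 : 0 <= be <= 1).

(** The last of [j] supply cells reaches demand cell [j - 1 + w], so [j + w] demand cells are
    sampled. *)
Definition mean_greedy j w : R :=
  bern al j (fun s => bern be (j + w) (fun t => (greedy L s t w)%:R)).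

(** The mean once an occupied supply cell has been read: [j] supply cells remain after it, so one
    more demand cell is in play. *)
Let mean_scan j w : R :=
  bern al j (fun s => bern be (j + w).+1 (fun t => (scan (greedy L s) t w)%:R)).

Let bern2S (N M : nat) (H : seq bool -> seq bool -> nat) :
  bern al N (fun s => bern be M (fun t => (H s t).+1%:R))
  = 1 + bern al N (fun s => bern be M (fun t => (H s t)%:R)).
Proof.
rewrite -bernS; apply: eq_bern => s _; rewrite -bernS.
by apply: eq_bern => t _; rewrite -nat1r.
Qed.

Let mean_scan0 j :
  mean_scan j 0 = be * (1 + mean_greedy j 0) + (1 - be) * mean_greedy j 0.
Proof. by rewrite /mean_scan /= bern_lin bern2S. Qed.

Let mean_scanS j w : mean_scan j w.+1 =
  be * (1 + mean_greedy j w.+1) + (1 - be) * mean_scan j w.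
Proof. by rewrite /mean_scan /= bern_lin bern2S /mean_greedy addnS. Qed.

Let mean_greedyS j w : mean_greedy j.+1 w =
  al * mean_scan j w +
  (1 - al) * mean_greedy j (if w < L.*2 then w.+1 else w)%N.
Proof.
rewrite {1}/mean_greedy -[LHS]/(_ * _ + _ * _) addSn; congr (_ * _ + _ * _).
rewrite /mean_greedy -[LHS]/(bern al j (fun s => bern be (j + w).+1 (fun t =>
  (if w < L.*2 then greedy L s t w.+1 else greedy L s (behead t) w)%N%:R))).
case: ifP => _; first by rewrite addnS.
apply: eq_bern => s _.
exact: (bern_behead be _ (fun t => (greedy L s t w)%:R)).
Qed.

Let convex_bound (K p u v : R) : 0 <= p <= 1 -> `|u| <= K -> `|v| <= K ->
  `|p * u + (1 - p) * v| <= K.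
Proof.
move=> /andP[p0 p1]; rewrite !ler_norml => /andP[u1 u2] /andP[v1 v2].
have q0 : 0 <= 1 - p by rewrite subr_ge0.
have := ler_wpM2l p0 u1; have := ler_wpM2l p0 u2.
have := ler_wpM2l q0 v1; have := ler_wpM2l q0 v2.
by move=> *; apply/andP; split; lra.
Qed.

(* [f] is a relative value function of the greedy chain with mean reward [c] per step:
   it solves the Poisson equation, so [mean_greedy j w - f w - j c] is an average of terminal
   values [- f], bounded uniformly in [j]. *)
Lemma mean_greedy_bound (f q : nat -> R) c K :
  q 0%N = be * (1 + f 0%N) + (1 - be) * f 0%N ->
  (forall w, q w.+1 = be * (1 + f w.+1) + (1 - be) * q w) ->
  (forall w, (w <= L.*2)%N ->
     al * q w + (1 - al) * f (if w < L.*2 then w.+1 else w)%N = f w + c) ->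
  (forall w, (w <= L.*2)%N -> `|f w| <= K) ->
  forall j w, (w <= L.*2)%N -> `|mean_greedy j w - j%:R * c| <= 2 * K.
Proof.
move=> q0 qS fq fK.
suff H j w : (w <= L.*2)%N -> `|mean_greedy j w - j%:R * c - f w| <= K.
  move=> j w wL; move: (H j w wL) (fK w wL); rewrite !ler_norml.
  by move=> /andP[? ?] /andP[? ?]; apply/andP; split; lra.
elim: j w => [|j IH] w wL.
  by rewrite /mean_greedy /= bern_cst mul0r subr0 sub0r normrN fK.
(* Within a scan the window shrinks one cell at a time, whence an inner induction on [v]. *)
have Q v : (v <= L.*2)%N -> `|mean_scan j v - j%:R * c - q v| <= K.
  elim: v => [|v IHv] vL.
    rewrite mean_scan0 q0.
    rewrite (_ : _ - _ = be * (mean_greedy j 0 - j%:R * c - f 0%N) +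
                 (1 - be) * (mean_greedy j 0 - j%:R * c - f 0%N)); last by ring.
    by apply: convex_bound; rewrite // IH.
  rewrite mean_scanS qS.
  rewrite (_ : _ - _ = be * (mean_greedy j v.+1 - j%:R * c - f v.+1) +
               (1 - be) * (mean_scan j v - j%:R * c - q v)); last by ring.
  by apply: convex_bound; rewrite ?IH // IHv // ltnW.
rewrite mean_greedyS -addrA -opprD.
set w' := if _ then _ else _.
rewrite (_ : j.+1%:R * c + f w = j%:R * c + (f w + c)); last by rewrite -natr1; ring.
rewrite -fq // -/w'.
rewrite (_ : _ - _ = al * (mean_scan j w - j%:R * c - q w) +
               (1 - al) * (mean_greedy j w' - j%:R * c - f w')); last by ring.
apply: convex_bound => //; first exact: Q.
by apply: IH; rewrite /w'; case: ifP.
Qed.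

End GreedyDrift.

Definition geom_sum x n : R := \sum_(i < n) x ^+ i.

Definition match_rate al be (L : nat) : R :=
  let rho := (1 - be) / (1 - al) in
  al * be * (rho ^+ L.*2 + geom_sum rho L.*2) /
  (rho ^+ L.*2 + be * geom_sum rho L.*2).

(* The increments [x w] of the relative value function obey [x (w + 1) = rho x w + be (c - al) / (1 - al)],
   and [c] is the value for which the cap at [2 L] is respected, i.e. [x (2 L) = 0]. *)
Lemma mean_greedy_rate al be (L : nat) : 0 < al < 1 -> 0 < be < 1 ->
  exists K, forall j w, (w <= L.*2)%N ->
    `|mean_greedy al be L j w - j%:R * match_rate al be L| <= K.
Proof.
move=> /andP[al0 al1] /andP[be0 be1].
set rho := (1 - be) / (1 - al); set c := match_rate al be L.
have rho0 : 0 < rho by rewrite /rho divr_gt0 // subr_gt0.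
pose x w := rho ^+ w * ((c - al * be) / (1 - al)) +
  be * (c - al) / (1 - al) * geom_sum rho w.
(* [f] is determined up to an additive constant, fixed here by [f 0 = 1]. [q] is solved from the
   Poisson equation without the cap; as [x (2 L) = 0], it satisfies the capped equation at [w = 2 L]
   too. *)
pose f w := 1 + \sum_(i < w) x i.
pose q w := (f w + c - (1 - al) * f w.+1) / al.
have a1 : 1 - al != 0 by rewrite subr_eq0 gt_eqF.
have a0 : al != 0 by rewrite gt_eqF.
have fS w : f w.+1 = f w + x w by rewrite /f big_ord_recr addrA.
have f0 : f 0%N = 1 by rewrite /f big_ord0 addr0.
have gS w : geom_sum rho w.+1 = rho * geom_sum rho w + 1.
  rewrite /geom_sum big_ord_recl expr0 addrC; congr (_ + _).
  by rewrite mulr_sumr; apply: eq_bigr => i _; rewrite exprS.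
have xS w : x w.+1 = rho * x w + be * (c - al) / (1 - al).
  by rewrite /x gS exprS; ring.
have x0 : x 0%N = (c - al * be) / (1 - al).
  by rewrite /x expr0 /geom_sum big_ord0 mulr0 addr0 mul1r.
have xL : x L.*2 = 0.
  rewrite /x /c /match_rate -/rho.
  have : rho ^+ L.*2 + be * geom_sum rho L.*2 != 0.
    rewrite gt_eqF // ltr_wpDr ?exprn_gt0 // mulr_ge0 ?(ltW be0) // sumr_ge0 //.
    by move=> i _; rewrite exprn_ge0 // ltW.
  by move: (rho ^+ _) (geom_sum _ _) => r g h; field; rewrite h a1.
exists (2 * \sum_(w < L.*2.+1) `|f w|) => j w.
have H := @mean_greedy_bound al be L _ _ f q c (\sum_(w < L.*2.+1) `|f w|) _ _ _ _.
apply: H; rewrite ?ltW //.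
- by rewrite /q fS f0 x0; field; rewrite a0 a1.
- by move=> v; rewrite /q !fS xS /rho; field; rewrite a0 a1.
- move=> v vL; rewrite /q; case: ltnP => vL'; first by rewrite fS; field.
  have -> : v = L.*2 by apply/eqP; rewrite eqn_leq vL.
  by rewrite fS xL; field.
- move=> v vL; rewrite (bigD1 (Ordinal (vL : (v < L.*2.+1)%N))) //= lerDl.
  by rewrite sumr_ge0.
Qed.

End Bernoulli.

(** * Symmetrization over permutations of the cells *)

Section Exchangeable.
Variables (R : realFieldType) (I : finType).

Definition set_lipschitz (phi : {set I} -> R) :=
  forall A A' : {set I}, A \subset A' -> `|phi A' - phi A| <= #|A' :\: A|%:R.

Lemma norm_sum_le_card (T : finType) (F : T -> R) a :
  (forall x, `|F x| <= a) -> `|\sum_x F x| <= #|T|%:R * a.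
Proof.
move=> Fa; rewrite (le_trans (ler_norm_sum _ _ _)) // mulr_natl -sumr_const.
exact: ler_sum.
Qed.

Lemma perm_imsetM (s t : {perm I}) (A : {set I}) :
  [set s x | x in [set t x | x in A]] = [set (t * s)%g x | x in A].
Proof.
by rewrite -imset_comp; apply: eq_imset => x; rewrite /= permM.
Qed.

Lemma card_perm_imset (s : {perm I}) (A : {set I}) : #|[set s x | x in A]| = #|A|.
Proof. by rewrite card_imset //; exact: perm_inj. Qed.

Lemma sum_perm_subset phi (A A' : {set I}) : set_lipschitz phi -> A \subset A' ->
  `|\sum_(s : {perm I}) phi [set s x | x in A'] -
    \sum_(s : {perm I}) phi [set s x | x in A]|
  <= #|{perm I}|%:R * `|#|A'|%:R - #|A|%:R|.
Proof.
move=> lip AA'; rewrite -sumrB; apply: norm_sum_le_card => s.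
apply: (le_trans (lip _ _ (imsetS s AA'))).
rewrite cardsD (finset.setIidPr (imsetS s AA')) !card_perm_imset natrB ?ler_norm //.
exact: subset_leq_card.
Qed.

(** The sum over all permutations does not change when a transposition is applied to [A]. Swapping a
    point of [A :\: A'] with one of [A' :\: A] shrinks [A :\: A'], until [A] is contained in [A']
    and the Lipschitz bound applies. *)
Lemma sum_perm_lipschitz phi (A A' : {set I}) : set_lipschitz phi ->
  `|\sum_(s : {perm I}) phi [set s x | x in A] -
    \sum_(s : {perm I}) phi [set s x | x in A']|
  <= #|{perm I}|%:R * `|#|A|%:R - #|A'|%:R|.
Proof.
move=> lip; wlog leA : A A' / (#|A| <= #|A'|)%N.
  move=> H; have [/H//|/ltnW/H] := leqP #|A| #|A'|.
  by rewrite distrC [X in _ <= _ * X]distrC.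
have [k] := ubnP #|A :\: A'|; elim: k => // k IH in A leA *; rewrite ltnS => kA.
have [AA'|/subsetPn[x xA xA']] := boolP (A \subset A').
  by rewrite distrC [X in _ <= _ * X]distrC; exact: sum_perm_subset.
have /subsetPn[y yA' yA] : ~~ (A' \subset A).
  apply: contra xA' => A'A; suff -> : A' = A by [].
  by apply/eqP; rewrite eqEcard A'A leA.
pose B := [set tperm x y z | z in A].
have <- : \sum_(s : {perm I}) phi [set s x | x in B] =
          \sum_(s : {perm I}) phi [set s x | x in A].
  rewrite [RHS](reindex_inj (mulgI (tperm x y))).
  by apply: eq_bigr => s _; rewrite perm_imsetM.
have cB : #|B| = #|A| by exact: card_perm_imset.
rewrite -cB; apply: IH; rewrite ?cB //.
apply: leq_trans kA; apply: proper_card; apply/properP; split.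
  apply/fintype.subsetP => z; rewrite !inE => /andP[zA' /imsetP[t tA zt]].
  rewrite zA' /=; move: zA'; rewrite {}zt.
  case: tpermP => [tx|ty|_ _ _ //]; first by rewrite yA'.
  by rewrite -ty tA in yA.
exists x; rewrite !inE xA' //=.
apply/imsetP => -[t tA xt].
have : y \in A by rewrite -(tpermL x y) [X in tperm x y X]xt tpermK.
by rewrite (negbTE yA).
Qed.

Variable Phi : {set I} -> {set I} -> R.
Hypothesis lip1 : forall B, set_lipschitz (Phi^~ B).
Hypothesis lip2 : forall A, set_lipschitz (Phi A).

Definition symmetrize (A B : {set I}) : R :=
  \sum_(s : {perm I}) \sum_(t : {perm I}) Phi [set s x | x in A] [set t x | x in B].

Lemma symmetrize_lipschitz (A A' B B' : {set I}) :
  `|symmetrize A B - symmetrize A' B'| <= #|{perm I}|%:R ^+ 2 *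
  (`|#|A|%:R - #|A'|%:R| + `|#|B|%:R - #|B'|%:R|).
Proof.
rewrite mulrDr.
have -> : symmetrize A B - symmetrize A' B' =
   (symmetrize A B - symmetrize A' B) + (symmetrize A' B - symmetrize A' B') by ring.
apply: le_trans (ler_normD _ _) _; apply: lerD.
- rewrite /symmetrize (exchange_big_dep xpredT) //= [X in _ - X](exchange_big_dep xpredT) //=.
  rewrite -sumrB expr2 -mulrA; apply: norm_sum_le_card => t.
  exact: (sum_perm_lipschitz _ _ (lip1 _)).
- rewrite /symmetrize -sumrB expr2 -mulrA; apply: norm_sum_le_card => s.
  exact: (sum_perm_lipschitz _ _ (lip2 _)).
Qed.

Variables (Om : finType) (w : Om -> R) (A B : Om -> {set I}).
Hypotheses (w0 : forall o, 0 <= w o) (w1 : \sum_o w o = 1).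
Hypothesis exchangeable : forall s t : {perm I},
  \sum_o w o * Phi [set s x | x in A o] [set t x | x in B o]
  = \sum_o w o * Phi (A o) (B o).

(** Averaging [exchangeable] over all pairs of permutations replaces [Phi] by its symmetrization,
    which depends on the two sets only through their sizes. Only the deviations of these sizes from
    those of [A0], [B0] remain. *)
Lemma exchangeable_mean (A0 B0 : {set I}) :
  `|\sum_o w o * Phi (A o) (B o) - symmetrize A0 B0 / #|{perm I}|%:R ^+ 2|
  <= \sum_o w o * (`|#|A o|%:R - #|A0|%:R| + `|#|B o|%:R - #|B0|%:R|).
Proof.
set P := #|{perm I}|%:R ^+ 2.
have P0 : 0 < P.
  by rewrite exprn_gt0 // ltr0n; apply/card_gt0P; exists 1%g.
have PE : \sum_o w o * Phi (A o) (B o) = (\sum_o w o * symmetrize (A o) (B o)) / P.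
  apply: (canRL (mulfK (lt0r_neq0 P0))); symmetry.
  transitivity (\sum_(s : {perm I}) \sum_(t : {perm I}) \sum_o
      w o * Phi [set s x | x in A o] [set t x | x in B o]).
    under eq_bigr do rewrite /symmetrize mulr_sumr.
    rewrite exchange_big /=; apply: eq_bigr => s _.
    under eq_bigr do rewrite mulr_sumr.
    by rewrite exchange_big.
  under eq_bigr => s _ do under eq_bigr => t _ do rewrite exchangeable.
  by rewrite !sumr_const -mulrnA -[LHS]mulr_natr natrM mulrC -expr2.
rewrite PE -mulrBl normrM [X in _ * X]gtr0_norm ?invr_gt0 // ler_pdivrMr //.
have -> : \sum_o w o * symmetrize (A o) (B o) - symmetrize A0 B0 =
  \sum_o w o * (symmetrize (A o) (B o) - symmetrize A0 B0).
  rewrite -[X in _ - X]mul1r -w1 mulr_suml -sumrB.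
  by apply: eq_bigr => o _; rewrite mulrBr.
rewrite (le_trans (ler_norm_sum _ _ _)) // mulr_suml ler_sum // => o _.
rewrite normrM ger0_norm // -mulrA ler_wpM2l // mulrC.
exact: symmetrize_lipschitz.
Qed.

End Exchangeable.

(** * Matchings between occupied cells of a grid *)

Section CellGraph.
Variables (N L : nat).
Implicit Types A B : {set 'I_N.+1}.

Definition cell_graph A B (i j : 'I_N.+1) : bool :=
  [&& i \in A, j \in B, i <= j + L & j <= i + L]%N.

Definition cell_matching A B : nat := max_matching_size (cell_graph A B).

Lemma cell_matching_sub A A' B B' : A \subset A' -> B \subset B' ->
  (cell_matching A B <= cell_matching A' B')%N.
Proof.
move=> /fintype.subsetP AA' /fintype.subsetP BB'.
rewrite /cell_matching; have [s sm <-] := max_seq_matching (cell_graph A B).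
apply: seq_matching_size; case/and3P: sm => u1 u2 es; apply/and3P; split=> //.
by apply: sub_all es => x /and4P[/AA' xA /BB' xB h1 h2]; apply/and4P.
Qed.

(** Only the edges at cells of [A' :\: A] or [B' :\: B] have to be dropped, at most one for each
    such cell. *)
Lemma cell_matching_diff A A' B B' : (cell_matching A' B' <=
  cell_matching A B + (#|A' :\: A| + #|B' :\: B|))%N.
Proof.
rewrite /cell_matching; have [s sm <-] := max_seq_matching (cell_graph A' B').
have := seq_matching_size_good (fun i => i \notin A' :\: A)
  (fun j => j \notin B' :\: B) sm.
move/leq_trans; apply; apply: leq_add; last first.
  by apply: leq_add; apply: subset_leq_card; apply/fintype.subsetP => i;
    rewrite inE /= negbK.
apply: seq_matching_size; set s' := (X in seq_matching _ X).
have /and3P[u1 u2 /allP es] : seq_matching (cell_graph A' B') s'.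
  exact: seq_matching_filter.
apply/and3P; split=> //; apply/allP => x xs'.
have /and4P[xA' xB' h1 h2] := es x xs'.
move: xs'; rewrite mem_filter !inE xA' xB' !andbT !negbK => /andP[/andP[xA xB] _].
exact/and4P.
Qed.

Definition set_of_bits (s : seq bool) : {set 'I_N.+1} :=
  [set i : 'I_N.+1 | nth false s i].

Definition bits_of_set A : seq bool := [seq i \in A | i <- enum 'I_N.+1].

Lemma size_bits_of_set A : size (bits_of_set A) = N.+1.
Proof. by rewrite size_map size_enum_ord. Qed.

Lemma bits_of_setK : cancel bits_of_set set_of_bits.
Proof.
move=> A; apply/setP => i; rewrite inE (nth_map i) ?size_enum_ord //.
by rewrite nth_ord_enum.
Qed.

Lemma set_of_bitsK s : size s = N.+1 -> bits_of_set (set_of_bits s) = s.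
Proof.
move=> sN; apply: (@eq_from_nth _ false); rewrite size_bits_of_set ?sN //.
move=> i iN; rewrite (nth_map ord0) ?size_enum_ord // inE.
by rewrite nth_enum_ord.
Qed.

Lemma count_bits_of_set A : count id (bits_of_set A) = #|A|.
Proof.
by rewrite count_map -sum1_count -sum1_card big_enum_cond.
Qed.

Lemma set_of_bits_take s : set_of_bits (take N.+1 s) = set_of_bits s.
Proof. by apply/setP => i; rewrite !inE nth_take. Qed.

(** For [w = L] the strip joins cells with [|i - j| <= L]. It has [L] extra demand cells past the
    right end, and these add at most [L] matches. *)
Lemma cell_matching_greedy s t : size s = N.+1 -> size t = (N.+1 + L)%N ->
  (cell_matching (set_of_bits s) (set_of_bits t) <= greedy L s t L
   <= cell_matching (set_of_bits s) (set_of_bits t) + L)%N.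
Proof.
move=> sN tN; have LL : (L <= L.*2)%N by rewrite -addnn leq_addr.
apply/andP; split.
  rewrite /cell_matching; have [m mm <-] := max_seq_matching (cell_graph (set_of_bits s) (set_of_bits t)).
  rewrite -(size_map (fun x => (val x.1, val x.2))).
  apply: (strip_le_greedy LL).
  apply: (seq_matching_map (f := val) (g := val) mm).
  - by move=> ? ? _ _; exact: val_inj.
  - by move=> ? ? _ _; exact: val_inj.
  - move=> x _; rewrite /cell_graph !inE => /and4P[h1 h2 h3 h4].
    apply/and4P; split=> //.
    by rewrite -addnn addnA leq_add2r.
have [m mm <-] := greedy_matching s t LL.
have /and3P[u1 u2 /allP em] := mm.
rewrite -(count_predC (fun x : nat * nat => x.2 < N.+1)%N) leq_add //.
- rewrite -size_filter; set m' := seq.filter _ m.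
  have m'm : seq_matching (strip L s t L) m' by exact: seq_matching_filter.
  have bnd x : x \in m' -> (x.1 < N.+1)%N && (x.2 < N.+1)%N.
    rewrite mem_filter => /andP[-> /em/and4P[xs _ _ _]]; rewrite andbT -sN.
    by move: xs; apply: contraTT; rewrite -leqNgt => /(nth_default false) ->.
  rewrite -(size_map (fun x => (inord x.1, inord x.2) : 'I_N.+1 * 'I_N.+1)).
  apply: seq_matching_size.
  apply: (seq_matching_map (f := @inord N) (g := @inord N) m'm).
  + move=> i i' /mapP[x /bnd/andP[x1 _] ->] /mapP[y /bnd/andP[y1 _] ->].
    by move/(congr1 val); rewrite /= !inordK.
  + move=> i i' /mapP[x /bnd/andP[_ x1] ->] /mapP[y /bnd/andP[_ y1] ->].
    by move/(congr1 val); rewrite /= !inordK.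
  + move=> x /bnd/andP[x1 x2] /and4P[h1 h2 h3 h4].
    rewrite /cell_graph !inE !inordK // h1 h2 /=.
    by move: h4; rewrite -addnn addnA leq_add2r => -> /=.
- rewrite -(count_map snd (fun j => ~~ (j < N.+1)%N)) -size_filter.
  have -> : L = size (iota N.+1 L) by rewrite size_iota.
  apply: uniq_leq_size; first exact: filter_uniq.
  move=> j; rewrite mem_filter mem_iota -leqNgt => /andP[-> /mapP[x /em/and4P[_ xt _ _] ->]] /=.
  rewrite -tN; move: xt; apply: contraTT; rewrite -leqNgt.
  by move=> /(nth_default false) ->.
Qed.

End CellGraph.

(** * Random sets of cells with independent membership *)

Section BernoulliSet.
Variables (R : realFieldType) (N : nat).
Implicit Types (p : R) (A : {set 'I_N.+1}).

Definition bern_weight p A : R := p ^+ #|A| * (1 - p) ^+ #|~: A|.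

Lemma bern_tuple p n F :
  bern p n F = \sum_(t : n.-tuple bool)
    p ^+ count id t * (1 - p) ^+ count negb t * F t.
Proof.
elim: n F => [|n IH] F.
  rewrite (big_pred1 [tuple]) /= ?expr0 ?mul1r // => t.
  by apply/esym/eqP; exact: tuple0.
have cons_bij : bijective (fun x : bool * n.-tuple bool => cons_tuple x.1 x.2).
  exists (fun t => (thead t, behead_tuple t)).
    by move=> [b t] /=; congr pair; apply: val_inj.
  by move=> t; apply: val_inj; rewrite /= [in RHS](tuple_eta t).
rewrite (reindex _ (onW_bij _ cons_bij)) /=.
rewrite -(pair_bigA _ (fun (b : bool) (t : n.-tuple bool) =>
  p ^+ (b + count id t) * (1 - p) ^+ (~~ b + count negb t) * F (b :: t))) /=.
rewrite (bigD1 true) //= (big_pred1 false); last by case.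
rewrite !IH !mulr_sumr; congr (_ + _); apply: eq_bigr => t _ /=.
  by rewrite add0n add1n exprS; ring.
by rewrite add0n add1n exprS; ring.
Qed.

Lemma bern_set p F : bern p N.+1 F =
  \sum_(A : {set 'I_N.+1}) bern_weight p A * F (bits_of_set A).
Proof.
have bits_size A : size (bits_of_set A) == N.+1 by rewrite size_bits_of_set.
have bits_bij : bijective (fun A => Tuple (bits_size A)).
  exists (fun t : N.+1.-tuple bool => set_of_bits N t) => [A|t] /=.
    exact: bits_of_setK.
  by apply: val_inj; rewrite /= set_of_bitsK // size_tuple.
rewrite bern_tuple (reindex _ (onW_bij _ bits_bij)) /=; apply: eq_bigr => A _.
rewrite /bern_weight count_bits_of_set; congr (_ * _ ^+ _ * _).
rewrite cardsCs finset.setCK card_ord -[RHS]/(N.+1 - #|A|)%N.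
have : (#|A| + count negb (bits_of_set A))%N = N.+1.
  by rewrite -count_bits_of_set count_predC size_bits_of_set.
by clear; lia.
Qed.

Lemma sum_bern_weight p : \sum_(A : {set 'I_N.+1}) bern_weight p A = 1.
Proof.
rewrite -[RHS](bern_cst p N.+1) bern_set.
by apply: eq_bigr => A _; rewrite mulr1.
Qed.

Lemma bern_weight_ge0 p A : 0 <= p <= 1 -> 0 <= bern_weight p A.
Proof. by case/andP=> p0 p1; rewrite mulr_ge0 // exprn_ge0 // subr_ge0. Qed.

Lemma bern_weight_perm p (s : {perm 'I_N.+1}) A :
  bern_weight p [set s x | x in A] = bern_weight p A.
Proof.
rewrite /bern_weight card_perm_imset; congr (_ * _ ^+ _).
by rewrite [LHS]cardsCs [RHS]cardsCs !finset.setCK card_perm_imset.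
Qed.

(** From [|y| <= (y ^ 2 / t + t) / 2] and the second moment; the free parameter [t] takes the place
    of a square root. *)
Lemma bern_card_dev p (x t : R) : 0 <= p <= 1 -> 0 < t ->
  \sum_(A : {set 'I_N.+1}) bern_weight p A * `|#|A|%:R - x|
  <= ((N.+1%:R * p * (1 - p) + (N.+1%:R * p - x) ^+ 2) / t + t) / 2.
Proof.
move=> p01 t0; rewrite -bern_moment2.
have -> : (bern p N.+1 (fun s => ((count id s)%:R - x) ^+ 2) / t + t) / 2 =
  bern p N.+1 (fun s => (2 * t)^-1 * ((count id s)%:R - x) ^+ 2 + 2^-1 * t).
  rewrite (bern_lin p N.+1 _ _ (fun s => ((count id s)%:R - x) ^+ 2) (fun=> t)).
  by rewrite bern_cst; field; rewrite gt_eqF.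
rewrite bern_set ler_sum // => A _; rewrite ler_wpM2l ?bern_weight_ge0 //.
rewrite count_bits_of_set -[in leRHS]real_normK ?num_real //.
move: `|_| => y.
rewrite -subr_ge0 (_ : _ - _ = (2 * t)^-1 * (y - t) ^+ 2); last first.
  by field; rewrite gt_eqF.
by rewrite mulr_ge0 ?sqr_ge0 // invr_ge0 mulr_ge0 // ltW.
Qed.

End BernoulliSet.

(** * Uniform assignments of locations to cells, and their collisions *)

Section UniformCells.
Variables (R : realFieldType) (n N : nat).
Implicit Types (c : {ffun 'I_n + 'I_n -> 'I_N.+1}) (F : {set 'I_n}).

Definition supply_cells F c : {set 'I_N.+1} := [set c (inl i) | i in F].
Definition demand_cells c : {set 'I_N.+1} := [set c (inr j) | j in [set: 'I_n]].

Definition collisions c : {set 'I_n + 'I_n} :=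
  [set v | [exists u, (u != v) && (c u == c v)]].

Definition uniform_mean (f : {ffun 'I_n + 'I_n -> 'I_N.+1} -> R) : R :=
  (\sum_c f c) / #|{ffun 'I_n + 'I_n -> 'I_N.+1}|%:R.

Lemma card_ffun_gt0 : 0 < #|{ffun 'I_n + 'I_n -> 'I_N.+1}|%:R :> R.
Proof. by rewrite ltr0n; apply/card_gt0P; exists [ffun=> ord0]. Qed.

Lemma uniform_mean_le f g : (forall c, f c <= g c) ->
  uniform_mean f <= uniform_mean g.
Proof.
move=> fg; rewrite /uniform_mean ler_pM2r ?invr_gt0 ?card_ffun_gt0 //.
by rewrite ler_sum.
Qed.

Lemma uniform_meanD f g :
  uniform_mean (fun c => f c + g c) = uniform_mean f + uniform_mean g.
Proof. by rewrite /uniform_mean big_split mulrDl. Qed.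

Lemma uniform_meanZ a f :
  uniform_mean (fun c => a * f c) = a * uniform_mean f.
Proof. by rewrite /uniform_mean -mulr_sumr mulrA. Qed.

(* Shifting one value by a uniform offset leaves the uniform law of c unchanged. *)
Lemma sum_pair_collision (u v : 'I_n + 'I_n) : u != v ->
  \sum_(c : {ffun 'I_n + 'I_n -> 'I_N.+1}) (c u == c v)%:R = #|{ffun 'I_n + 'I_n -> 'I_N.+1}|%:R / N.+1%:R :> R.
Proof.
move=> uv; apply: (canRL (mulfK _)); first by rewrite pnatr_eq0.
pose sh (k : 'I_N.+1) c := [ffun x => if x == u then c x + k else c x].
have shK k : cancel (sh k) (sh (- k)).
  by move=> c; apply/ffunP => x; rewrite !ffunE; case: eqP => // _; rewrite addrK.
have shE k : \sum_c ((c : {ffun 'I_n + 'I_n -> 'I_N.+1}) u == c v)%:R =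
    \sum_c ((c : {ffun 'I_n + 'I_n -> 'I_N.+1}) u + k == c v)%:R :> R.
  rewrite (reindex_inj (can_inj (shK k))); apply: eq_bigr => c _.
  by rewrite !ffunE eqxx eq_sym [v == u]eq_sym (negbTE uv) eq_sym.
transitivity (\sum_(k : 'I_N.+1) \sum_c
    ((c : {ffun 'I_n + 'I_n -> 'I_N.+1}) u == c v)%:R : R).
  by rewrite sumr_const card_ord mulr_natr.
rewrite (eq_bigr _ (fun k _ => shE k)) exchange_big /=.
rewrite -sum1_card natr_sum; apply: eq_bigr => c _.
(* Exactly one offset in the cyclic group ['I_N.+1] moves [c u] onto [c v]. *)
rewrite (bigD1 (c v - c u)) //= big1 ?addr0; last first.
  move=> k; apply: contraNeq; rewrite pnatr_eq0 eqb0 negbK => /eqP <-.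
  by rewrite addrC addKr.
by rewrite addrC subrK eqxx.
Qed.

(** Union bound over ordered pairs of distinct locations; the diagonal is added to obtain the full
    square. *)
Lemma uniform_mean_collisions :
  uniform_mean (fun c => #|collisions c|%:R) <= (n + n)%:R ^+ 2 / N.+1%:R.
Proof.
rewrite /uniform_mean ler_pdivrMr ?card_ffun_gt0 //.
have le c : #|collisions c|%:R <=
    \sum_(v : 'I_n + 'I_n) \sum_(u | u != v) (c u == c v)%:R :> R.
  rewrite -sum1_card natr_sum big_mkcond /= ler_sum // => v _.
  rewrite inE; case: ifP => [/existsP[u /andP[uv cuv]]|_]; last first.
    by rewrite sumr_ge0.
  by rewrite (bigD1 u) //= cuv lerDl sumr_ge0.
apply: (le_trans (ler_sum _ (fun c _ => le c))).
rewrite exchange_big /=.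
have -> : (n + n)%:R ^+ 2 / N.+1%:R * #|{ffun 'I_n + 'I_n -> 'I_N.+1}|%:R =
   \sum_(v : 'I_n + 'I_n) \sum_(u : 'I_n + 'I_n)
      #|{ffun 'I_n + 'I_n -> 'I_N.+1}|%:R / N.+1%:R :> R.
  rewrite !sumr_const card_sum card_ord -!mulrnA -[RHS]mulr_natr natrM.
  by rewrite -[RHS]mulrA; ring.
apply: ler_sum => v _; rewrite exchange_big /= [leRHS](bigID (fun u => u != v)) /=.
rewrite -[leLHS]addr0 lerD //.
  by apply: ler_sum => u uv; rewrite sum_pair_collision.
by rewrite sumr_ge0 // => u _; rewrite divr_ge0.
Qed.

(** The indices without a collision are mapped injectively. *)
Lemma card_imset_collisions (W : finType) (h : W -> 'I_n + 'I_n) (F : {set W}) c :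
  injective h ->
  `|#|[set c (h i) | i in F]|%:R - #|F|%:R| <= #|collisions c|%:R :> R.
Proof.
move=> hi.
have imF : (#|[set c (h i) | i in F]| <= #|F|)%N by exact: leq_imset_card.
rewrite distrC ger0_norm ?subr_ge0 ?ler_nat // -natrB // ler_nat leq_subLR.
pose G := [set i in F | h i \notin collisions c].
have FG : (#|F| <= #|G| + #|collisions c|)%N.
  rewrite -(cardsID G F) leq_add //.
    by rewrite subset_leq_card // finset.subsetIr.
  rewrite -(card_imset _ hi) subset_leq_card //; apply/fintype.subsetP => v.
  by case/imsetP => i; rewrite inE => /andP[+ iF] ->; rewrite inE iF /= negbK.
apply: (leq_trans FG); rewrite leq_add2r.
have <- : #|[set c (h i) | i in G]| = #|G|.
  apply: card_in_imset => i j; rewrite inE => /andP[iF ib] _ cij.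
  apply/eqP; apply: contraNT ib => ij; rewrite inE; apply/existsP; exists (h j).
  by rewrite (inj_eq hi) eq_sym ij /= cij.
apply: subset_leq_card; apply: imsetS; apply/fintype.subsetP => i.
by rewrite inE => /andP[].
Qed.

End UniformCells.

(** * Comparison of uniform locations with Bernoulli cells *)

Section UniformBernoulli.
Variable R : realFieldType.

Lemma cell_matching_lipschitz N L (B A A' : {set 'I_N.+1}) : A \subset A' ->
  `|(cell_matching L A' B)%:R - (cell_matching L A B)%:R| <= #|A' :\: A|%:R :> R.
Proof.
move=> AA'; have le := cell_matching_sub L AA' (subxx B).
rewrite ger0_norm ?subr_ge0 ?ler_nat // -natrB // ler_nat leq_subLR.
by apply: (leq_trans (cell_matching_diff L A A' B B)); rewrite finset.setDv cards0 addn0.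
Qed.

Lemma cell_matching_lipschitzr N L (A B B' : {set 'I_N.+1}) : B \subset B' ->
  `|(cell_matching L A B')%:R - (cell_matching L A B)%:R| <= #|B' :\: B|%:R :> R.
Proof.
move=> BB'; have le := cell_matching_sub L (subxx A) BB'.
rewrite ger0_norm ?subr_ge0 ?ler_nat // -natrB // ler_nat leq_subLR.
by apply: (leq_trans (cell_matching_diff L A A B B')); rewrite finset.setDv cards0 add0n.
Qed.

#[local] Arguments bern : simpl never.

Definition bern_cell_matching N L (al be : R) : R :=
  \sum_(x : {set 'I_N.+1} * {set 'I_N.+1})
    bern_weight al x.1 * bern_weight be x.2 * (cell_matching L x.1 x.2)%:R.

Lemma bern_cell_matching_greedy N L (al be : R) : 0 <= al <= 1 -> 0 <= be <= 1 ->
  `|bern_cell_matching N L al be - mean_greedy al be L N.+1 L| <= L%:R.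
Proof.
move=> al01 be01.
have -> : bern_cell_matching N L al be = bern al N.+1 (fun s =>
   bern be (N.+1 + L) (fun t => (cell_matching L (set_of_bits N s) (set_of_bits N t))%:R)).
  transitivity (bern al N.+1 (fun s => bern be N.+1 (fun t =>
      (cell_matching L (set_of_bits N s) (set_of_bits N t))%:R : R))); last first.
    (* The [L] extra demand bits are invisible to [set_of_bits] and integrate out. *)
    apply: eq_bern => s _; symmetry; apply: (bern_take be (N := N.+1)) => t.
    by rewrite set_of_bits_take.
  rewrite bern_set /bern_cell_matching.
  rewrite -(pair_bigA _ (fun A B : {set 'I_N.+1} =>
     bern_weight al A * bern_weight be B * (cell_matching L A B)%:R)) /=.
  apply: eq_bigr => A _; rewrite bern_set mulr_sumr; apply: eq_bigr => B _; cbv beta.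
  by rewrite !bits_of_setK mulrA.
set X := bern _ _ _; rewrite /mean_greedy; set Y := bern _ _ _.
have h1 : X <= Y.
  apply: bern_le => // s sN; apply: bern_le => // t tN; rewrite ler_nat.
  by have /andP[] := cell_matching_greedy sN tN.
have h2 : Y <= L%:R + X.
  rewrite -bernS; apply: bern_le => // s sN; rewrite -bernS; apply: bern_le => // t tN.
  by rewrite -natrD ler_nat addnC; have /andP[] := cell_matching_greedy sN tN.
by rewrite ler_norml; apply/andP; split; lra.
Qed.

(** [bern_weight] depends only on the cardinality, so permuting the two sets is a change of
    variables; [bern_card_dev] bounds the size deviations. *)
Lemma bern_cell_matching_symmetrize N L (al be t : R) (A0 B0 : {set 'I_N.+1}) :
  0 <= al <= 1 -> 0 <= be <= 1 -> 0 < t ->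
  `|bern_cell_matching N L al be -
    symmetrize (fun A B => (cell_matching L A B)%:R : R) A0 B0 /
      #|{perm 'I_N.+1}|%:R ^+ 2| <=
  ((N.+1%:R * al * (1 - al) + (N.+1%:R * al - #|A0|%:R) ^+ 2) / t + t) / 2 +
  ((N.+1%:R * be * (1 - be) + (N.+1%:R * be - #|B0|%:R) ^+ 2) / t + t) / 2.
Proof.
move=> al01 be01 t0.
apply: (le_trans (exchangeable_mean _ _ _ _ _ _ _)).
- by move=> B A A'; exact: cell_matching_lipschitz.
- by move=> A B B'; exact: cell_matching_lipschitzr.
- by move=> o; rewrite mulr_ge0 // bern_weight_ge0.
- rewrite -(pair_bigA _ (fun A B : {set 'I_N.+1} => bern_weight al A * bern_weight be B)) /=.
  under eq_bigr do rewrite -mulr_sumr sum_bern_weight mulr1.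
  exact: sum_bern_weight.
- move=> s t'.
  pose g (x : {set 'I_N.+1} * {set 'I_N.+1}) :=
    ([set s i | i in x.1], [set t' i | i in x.2]).
  have gi : injective g.
    move=> [A B] [A' B'] [] /(imset_inj (@perm_inj _ s)) -> .
    by move=> /(imset_inj (@perm_inj _ t')) ->.
  rewrite [RHS](reindex_inj gi); apply: eq_bigr => x _.
  by rewrite !bern_weight_perm.
have e1 (x : {set 'I_N.+1} * {set 'I_N.+1}) :
  bern_weight al x.1 * bern_weight be x.2 *
   (`|#|x.1|%:R - #|A0|%:R| + `|#|x.2|%:R - #|B0|%:R|) =
  bern_weight be x.2 * (bern_weight al x.1 * `|#|x.1|%:R - #|A0|%:R|) +
  bern_weight al x.1 * (bern_weight be x.2 * `|#|x.2|%:R - #|B0|%:R|) by ring.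
under eq_bigr do rewrite e1.
rewrite big_split /=; apply: lerD.
- rewrite -(pair_bigA _ (fun A B : {set 'I_N.+1} =>
    bern_weight be B * (bern_weight al A * `|#|A|%:R - #|A0|%:R|))) /=.
  under eq_bigr do rewrite -mulr_suml sum_bern_weight mul1r.
  exact: bern_card_dev.
- rewrite -(pair_bigA _ (fun A B : {set 'I_N.+1} =>
    bern_weight al A * (bern_weight be B * `|#|B|%:R - #|B0|%:R|))) /=.
  under eq_bigr do rewrite -mulr_sumr.
  by rewrite -mulr_suml sum_bern_weight mul1r; exact: bern_card_dev.
Qed.

(** Composing with [s] on suppliers and [t] on demands permutes the assignments, which gives
    exchangeability. The occupied sets miss the sizes [#|F|] and [n] by at most the number of
    collisions, once per side: hence the factor 2. *)
Lemma uniform_cell_matching_symmetrize n N L (F : {set 'I_n}) (A0 B0 : {set 'I_N.+1}) :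
  #|A0| = #|F| -> #|B0| = n ->
  `|uniform_mean (fun c : {ffun 'I_n + 'I_n -> 'I_N.+1} =>
       (cell_matching L (supply_cells F c) (demand_cells c))%:R) -
    symmetrize (fun A B => (cell_matching L A B)%:R : R) A0 B0 /
      #|{perm 'I_N.+1}|%:R ^+ 2| <= 2 * ((n + n)%:R ^+ 2 / N.+1%:R).
Proof.
move=> cA0 cB0; pose T : finType := {ffun 'I_n + 'I_n -> 'I_N.+1}.
have T0 : 0 < #|T|%:R :> R by exact: card_ffun_gt0.
rewrite /uniform_mean mulrC mulr_sumr.
apply: (le_trans (exchangeable_mean _ _ _ _ _ _ _)).
- by move=> B A A'; exact: cell_matching_lipschitz.
- by move=> A B B'; exact: cell_matching_lipschitzr.
- by move=> o; rewrite invr_ge0 ltW.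
- by rewrite sumr_const -[LHS]mulr_natr mulVf // gt_eqF.
- move=> s t.
  pose g (c : T) : T := [ffun v => match v with inl _ => s (c v) | inr _ => t (c v) end].
  have gi : injective g.
    move=> c c' /ffunP cc'; apply/ffunP => v; have := cc' v; rewrite !ffunE.
    by case: v => i /perm_inj.
  rewrite [RHS](reindex_inj gi); apply: eq_bigr => c _.
  congr (_ * (cell_matching L _ _)%:R).
    by rewrite /supply_cells -imset_comp; apply: eq_imset => i; rewrite /= ffunE.
  by rewrite /demand_cells -imset_comp; apply: eq_imset => i; rewrite /= ffunE.
rewrite -mulr_sumr mulrC.
apply: (@le_trans _ _ (uniform_mean (fun c : T => 2 * #|collisions c|%:R))).
  apply: uniform_mean_le => c; rewrite mulr_natl mulr2n cA0 cB0; apply: lerD.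
    by apply: (card_imset_collisions R F c (h := inl)) => ? ? [].
  rewrite -[n in (_ - n%:R)](card_ord n) -cardsT.
  by apply: (card_imset_collisions R _ c (h := inr)) => ? ? [].
rewrite uniform_meanZ ler_wpM2l //.
exact: uniform_mean_collisions.
Qed.

Lemma card_ord_lt N k : (k <= N)%N -> #|[set i : 'I_N | i < k]%N| = k.
Proof.
move=> kN; rewrite cardsE -sum1_card.
by rewrite (big_ord_narrow kN) sum1_card card_ord.
Qed.

(* Both models are compared with a pair of sets of the deterministic sizes [#|F|], [n]. *)
Lemma uniform_cell_matching_rate (p : R) (m L : nat) : 0 < p <= 1 -> (1 < m)%N ->
  exists K, forall n N (F : {set 'I_n}), (0 < n)%N -> N.+1 = (n * m)%N ->
    `|#|F|%:R - p * n%:R| < 1 ->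
    `|uniform_mean (fun c : {ffun 'I_n + 'I_n -> 'I_N.+1} =>
         (cell_matching L (supply_cells F c) (demand_cells c))%:R) -
      n%:R * (m%:R * match_rate (p / m%:R) (m%:R^-1) L)| <= 9 * n%:R / m%:R + K.
Proof.
move=> /andP[p0 p1] m1.
have m1' : 1 < m%:R :> R by rewrite ltr1n.
have m0' : 0 < m%:R :> R by lra.
have mV1 : m%:R^-1 < 1 :> R by rewrite invf_lt1.
have mV0 : 0 < m%:R^-1 :> R by rewrite invr_gt0.
have al01 : 0 < p / m%:R < 1.
  by rewrite divr_gt0 //= ltr_pdivrMr // mul1r; lra.
have be01 : 0 < (m%:R^-1 : R) < 1 by apply/andP.
have [K HK] := mean_greedy_rate L al01 be01.
(* [2 m] covers the variance terms, [L] the extra demand cells, and [K] the bounded error of the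
   greedy mean. *)
exists (2 * m%:R + L%:R + K) => n N F n0 Nnm Fp.
have n0' : 1 <= n%:R :> R by rewrite ler1n.
have NE : N.+1%:R = n%:R * m%:R :> R by rewrite Nnm natrM.
have nN : (n <= N.+1)%N by rewrite Nnm leq_pmulr // ltnW.
have FN : (#|F| <= N.+1)%N by rewrite (leq_trans _ nN) // -[leqRHS]card_ord max_card.
have h1 := uniform_cell_matching_symmetrize L (card_ord_lt FN) (card_ord_lt nN).
(* The choice [t = n / m] makes the variance terms [O(m)], independent of [n], and leaves [n / m].
   With [8 n / m] from collisions this gives [9 n / m]. *)
have t0 : 0 < n%:R / m%:R :> R by rewrite divr_gt0 //; lra.
have [al01w be01w] : 0 <= p / m%:R <= 1 /\ 0 <= (m%:R^-1 : R) <= 1.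
  by split; move: al01 be01; lra.
have h2 := bern_cell_matching_symmetrize L [set i : 'I_N.+1 | i < #|F|]%N
  [set i : 'I_N.+1 | i < n]%N al01w be01w t0.
have h3 := bern_cell_matching_greedy N L al01w be01w.
have LL : (L <= L.*2)%N by rewrite -addnn leq_addr.
have h4 := HK N.+1 L LL.
move: h1 h2 h3 h4; rewrite !card_ord_lt // !NE.
move: (uniform_mean _) (symmetrize _ _ _ / _) (bern_cell_matching _ _ _ _)
   (mean_greedy _ _ _ _ _) (match_rate _ _ _) => u v x y z h1 h2 h3 h4.
have e1 : (n + n)%:R ^+ 2 / (n%:R * m%:R) = 4 * (n%:R / m%:R) :> R.
  by rewrite natrD; field; rewrite !gt_eqF //; lra.
have e2 : n%:R * m%:R * (p / m%:R) = p * n%:R by field; rewrite gt_eqF.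
have e3 : n%:R * m%:R * m%:R^-1 = n%:R :> R by rewrite mulfK ?gt_eqF.
have d1 : (p * n%:R - #|F|%:R) ^+ 2 <= 1.
  rewrite -real_normK ?num_real // distrC expr_le1 //; exact: ltW.
have pn : p * n%:R <= n%:R by rewrite ler_piMl //; lra.
have d2 : (p * n%:R * (1 - p / m%:R) + (p * n%:R - #|F|%:R) ^+ 2) / (n%:R / m%:R) <= 2 * m%:R.
  rewrite ler_pdivrMr // (_ : 2 * m%:R * _ = n%:R + n%:R); last first.
    by field; rewrite gt_eqF.
  apply: lerD; last by lra.
  apply: le_trans pn; rewrite ler_piMr ?mulr_ge0 ?ltW //; move: al01; lra.
have d3 : (n%:R * (1 - m%:R^-1) + (n%:R - n%:R) ^+ 2) / (n%:R / m%:R) <= m%:R :> R.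
  rewrite subrr expr0n addr0 ler_pdivrMr // (_ : m%:R * _ = n%:R); last first.
    by field; rewrite gt_eqF.
  by rewrite ler_piMr //; lra.
move: h1 h2; rewrite e1 e2 e3 => h1 h2.
rewrite (_ : 9 * n%:R / m%:R = 9 * (n%:R / m%:R)); last by rewrite mulrA.
move: h1 h2 h3 h4; rewrite !ler_norml => /andP[? ?] /andP[? ?] /andP[? ?] /andP[? ?].
have zE : n%:R * (m%:R * z) = n%:R * m%:R * z by rewrite mulrA.
by rewrite zE; apply/andP; split; lra.
Qed.

End UniformBernoulli.

(** * From points to cells *)

Section Cells.
Variables (R : realType) (N : nat).

(* Points outside [0, 1] fall into an extreme cell, so that the cells cover R. *)
Definition cell (x : R) : 'I_N.+1 := inord (minn N (Num.truncn (N.+1%:R * x))).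

Lemma cell_gt k (x : R) : (k < N)%N -> (k < cell x)%N = (k.+1%:R <= N.+1%:R * x).
Proof.
by move=> kN; rewrite inordK ?ltnS ?geq_minl // leq_min kN truncn_gt_nat.
Qed.

Lemma cell_le_mul (x : R) : 0 <= x -> (cell x)%:R <= N.+1%:R * x.
Proof.
move=> x0; case E: (nat_of_ord (cell x)) => [|k]; first by rewrite mulr_ge0.
have kN : (k < N)%N by rewrite -ltnS -E ltn_ord.
by rewrite -cell_gt // E.
Qed.

Lemma mul_le_cell (x : R) : x <= 1 -> N.+1%:R * x <= (cell x).+1%:R.
Proof.
move=> x1; have := ltn_ord (cell x); rewrite ltnS leq_eqVlt => /orP[/eqP ->|lt].
  by rewrite ler_piMr.
by rewrite leNgt; apply/negP => /ltW; rewrite -cell_gt // ltnn.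
Qed.

(** [floor X - floor Y <= floor (X - Y) + 1], and clamping to the extreme cells only brings indices
    closer. *)
Lemma cell_close (x y d : R) : `|x - y| <= d ->
  (cell x <= cell y + (Num.truncn (N.+1%:R * d)).+1)%N.
Proof.
move=> xyd; rewrite leqNgt; apply/negP => lt.
have := ltn_ord (cell x); rewrite ltnS; move: lt.
case E: (nat_of_ord (cell x)) => [//|k]; rewrite ltnS => lt kN.
have h1 : k.+1%:R <= N.+1%:R * x by rewrite -cell_gt // E.
have yk : (cell y < k)%N by apply: leq_trans lt; rewrite addnS ltnS leq_addr.
have h2 : N.+1%:R * y < (cell y).+1%:R.
  by rewrite ltNge -cell_gt ?ltnn // (ltn_trans yk).
have h3 : N.+1%:R * d < (Num.truncn (N.+1%:R * d)).+1%:R by exact: truncnS_gt.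
have h4 : N.+1%:R * (x - y) <= N.+1%:R * d.
  by rewrite ler_wpM2l // (le_trans (ler_norm _)).
move: lt; rewrite -(ler_nat R) natrD; move: h1 h2 h3 h4.
rewrite -(@natr1 R k) -(@natr1 R (cell y)); move: (Num.truncn _) => t.
by rewrite mulrBr; lra.
Qed.

(** Points of [0, 1] whose cell indices differ by at most [L] are at most [L + 1] cell widths
    apart. *)
Lemma close_cell (x y d : R) (L : nat) : 0 <= x <= 1 -> 0 <= y <= 1 ->
  L.+1%:R <= N.+1%:R * d -> (cell x <= cell y + L)%N -> (cell y <= cell x + L)%N ->
  `|x - y| <= d.
Proof.
move=> /andP[x0 x1] /andP[y0 y1] Ld; rewrite -!(ler_nat R) !natrD => xy yx.
have N0 : 0 < N.+1%:R :> R by [].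
move: (cell_le_mul x0) (cell_le_mul y0) (mul_le_cell x1) (mul_le_cell y1).
move: Ld; rewrite -!(@natr1 R L) -(@natr1 R (cell x)) -(@natr1 R (cell y)) => ? ? ? ? ?.
rewrite -(ler_pM2l N0) -{1}(gtr0_norm N0) -normrM mulrBr ler_norml.
by apply/andP; split; lra.
Qed.

Variables (n : nat) (a : R) (F : {set 'I_n}) (x y : 'I_n -> R).

Definition location_cells : {ffun 'I_n + 'I_n -> 'I_N.+1} :=
  [ffun v => cell (match v with inl i => x i | inr j => y j end)].

(** Edges with a colliding endpoint are dropped; on the remaining endpoints the map to cells is
    injective and carries the matching over. *)
Lemma matching_le_cells : (max_matching_size (service_graph 0 a F x y) <=
  cell_matching (Num.truncn (N.+1%:R * (a / n%:R))).+1
     (supply_cells F location_cells) (demand_cells location_cells)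
  + #|collisions location_cells|)%N.
Proof.
set c := location_cells; set L := _.+1.
have [s sm <-] := max_seq_matching (service_graph 0 a F x y).
apply: (leq_trans (seq_matching_size_good (fun i => inl i \notin collisions c)
  (fun j => inr j \notin collisions c) sm)).
apply: leq_add.
- set s' := (X in size X).
  have s'm : seq_matching (service_graph 0 a F x y) s' by exact: seq_matching_filter.
  have good e : e \in s' -> (inl e.1 \notin collisions c) && (inr e.2 \notin collisions c).
    by rewrite mem_filter => /andP[].
  rewrite -(size_map (fun e => (c (inl e.1), c (inr e.2)))).
  apply: seq_matching_size.
  apply: (seq_matching_map (f := fun i => c (inl i)) (g := fun j => c (inr j)) s'm).
  + move=> i i' /mapP[e es ->] /mapP[e' es' ->] ce; apply/eqP.
    have /andP[+ _] := good _ es; apply: contraNT => ee'.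
    by rewrite inE; apply/existsP; exists (inl e'.1); rewrite eq_sym ee' /= ce.
  + move=> i i' /mapP[e es ->] /mapP[e' es' ->] ce; apply/eqP.
    have /andP[_ +] := good _ es; apply: contraNT => ee'.
    by rewrite inE; apply/existsP; exists (inr e'.2); rewrite eq_sym ee' /= ce.
  + move=> e es; rewrite /service_graph /service_range add0r.
    case: ifP => [eF close|_]; last first.
      (* An inflexible supplier has range 0: an edge there forces equal locations, hence a
         collision, which was excluded. *)
      rewrite mul0r normr_le0 subr_eq0 => /eqP xy.
      have /andP[/negP bad _] := good _ es; case: bad; rewrite inE; apply/existsP.
      by exists (inr e.2); rewrite !ffunE xy eqxx.
    apply/and4P; split.
    * by apply/imsetP; exists e.1.
    * by apply/imsetP; exists e.2.
    * by rewrite !ffunE; exact: cell_close.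
    * by rewrite !ffunE; apply: cell_close; rewrite distrC.
- rewrite -(card_imset _ (@inl_inj 'I_n 'I_n)) -[X in (_ + X)%N](card_imset _ (@inr_inj 'I_n 'I_n)).
  rewrite -cardsUI [X in (_ + X)%N]eq_card0 ?addn0; last first.
    by move=> v; rewrite !inE; apply/negP => /andP[/imsetP[i _ ->] /imsetP[j _]].
  apply: subset_leq_card; apply/fintype.subsetP => v; rewrite finset.in_setU.
  by move=> /orP[] /imsetP[i +] ->; rewrite inE /= negbK.
Qed.

(** One location is chosen in each matched cell, a flexible one on the supply side; distinct cells
    give distinct locations. *)
Lemma cells_le_matching (L : nat) : (0 < n)%N ->
  (forall i, 0 <= x i <= 1) -> (forall j, 0 <= y j <= 1) ->
  L.+1%:R <= N.+1%:R * (a / n%:R) ->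
  (cell_matching L (supply_cells F location_cells) (demand_cells location_cells)
   <= max_matching_size (service_graph 0 a F x y))%N.
Proof.
move=> n0 x01 y01 La; set c := location_cells.
rewrite /cell_matching.
have [s sm <-] := max_seq_matching (cell_graph L (supply_cells F c) (demand_cells c)).
(* The default [Ordinal n0] is never returned on an occupied cell. *)
pose f k := odflt (Ordinal n0) [pick i in F | c (inl i) == k].
pose g k := odflt (Ordinal n0) [pick j | c (inr j) == k].
have fP k : k \in supply_cells F c -> (f k \in F) /\ c (inl (f k)) = k.
  case/imsetP => i iF ->; rewrite /f; case: pickP => [i' /andP[? /eqP ?]|/(_ i)] //=.
  by rewrite iF eqxx.
have gP k : k \in demand_cells c -> c (inr (g k)) = k.
  case/imsetP => i iF ->; rewrite /g; case: pickP => [i' /eqP ?|/(_ i)] //=.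
  by rewrite eqxx.
have /and3P[_ _ /allP es] := sm.
rewrite -(size_map (fun e => (f e.1, g e.2))).
apply: seq_matching_size; apply: (seq_matching_map sm).
- move=> k k' /mapP[e /es/and4P[/fP[_ fe] _ _ _] ->] /mapP[e' /es/and4P[/fP[_ fe'] _ _ _] ->].
  by move=> ff; rewrite -fe -fe' ff.
- move=> k k' /mapP[e /es/and4P[_ /gP fe _ _] ->] /mapP[e' /es/and4P[_ /gP fe' _ _] ->].
  by move=> ff; rewrite -fe -fe' ff.
- move=> e _ /and4P[/fP[fF fe] /gP ge h1 h2].
  rewrite /service_graph /service_range fF add0r.
  apply: (close_cell (x01 _) (y01 _) La).
    by move: h1; rewrite -{1}fe -{1}ge !ffunE.
  by move: h2; rewrite -{1}fe -{1}ge !ffunE.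
Qed.

End Cells.

Local Open Scope classical_set_scope.

(** * Expectations of functions of the random cells *)

Section FiniteRange.
Context (d : measure_display) (T : measurableType d) (R : realType).
Variables (P : probability T R) (V : finType) (h : T -> V).
Hypothesis mh : forall v, measurable (h @^-1` [set v]).

Lemma measurable_finite_range (f : V -> R) : measurable_fun setT (f \o h).
Proof.
move=> _ Y _; rewrite setTI.
have -> : (f \o h) @^-1` Y = \bigcup_(v in f @^-1` Y) h @^-1` [set v].
  apply/seteqP; split => [w Yw|w [v Yv /= hv]]; last by rewrite hv.
  by exists (h w).
by apply: fin_bigcup_measurable => //; exact: finite_finset.
Qed.

Lemma expectation_finite_range (f : V -> R) : (forall v, 0 <= f v) ->
  ('E_P[f \o h] = \sum_v (f v)%:E * P (h @^-1` [set v]))%E.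
Proof.
move=> f0; rewrite unlock.
transitivity (\int[P]_w (\sum_(v <- index_enum V) (f v * \1_(h @^-1` [set v]) w)%:E))%E.
  apply: eq_integral => w _; rewrite sumEFin; congr EFin.
  rewrite (bigD1 (h w)) //= big1 ?addr0 => [|v vh].
    by rewrite indicE mem_set // mulr1.
  by rewrite indicE memNset ?mulr0 // => /= hv; rewrite hv eqxx in vh.
have m1 v : measurable_fun [set: T] (\1_(h @^-1` [set v]) : T -> R).
  exact: measurable_indic.
rewrite ge0_integral_sum //.
- apply: eq_bigr => v _.
  under eq_integral do rewrite EFinM.
  rewrite ge0_integralZl //.
  + by rewrite integral_indic // setIT.
  + exact/measurable_EFinP.
  + by rewrite lee_fin.
- move=> v; apply/measurable_EFinP; apply: measurable_funM => //.
- by move=> v w _; rewrite lee_fin mulr_ge0.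
Qed.

End FiniteRange.

Section CellLaw.
Variables (R : realType) (N : nat).

Lemma measurable_cell (k : 'I_N.+1) : measurable (@cell R N @^-1` [set k]).
Proof.
(* Upper level sets of [cell] are half-lines, everything or empty; each cell is a difference of two
   of them. *)
have mge j : measurable [set x : R | (j <= cell N x)%N].
  case: j => [|j].
    by rewrite (_ : [set _ | _] = setT) //; apply/seteqP.
  have [jN|Nj] := ltnP j N.
    rewrite (_ : [set _ | _] = `[j.+1%:R / N.+1%:R, +oo[) //.
    by apply/seteqP; split => x /=; rewrite cell_gt // in_itv /= andbT ler_pdivrMr // mulrC.
  rewrite (_ : [set _ | _] = set0) //; apply/seteqP; split => // x /=.
  by move=> h; have := ltn_ord (cell N x); rewrite ltnNge (leq_trans _ h).
rewrite (_ : _ @^-1` _ = [set x : R | (k <= cell N x)%N] `\` [set x : R | (k.+1 <= cell N x)%N]).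
  exact: measurableD.
apply/seteqP; split => x /=; first by move=> ->; rewrite ltnn.
by move=> [kx /negP]; rewrite -leqNgt => xk; apply/val_inj/eqP; rewrite eqn_leq xk.
Qed.

Lemma uniform_cell (k : 'I_N.+1) :
  uniform_prob (@ltr01 R) (@cell R N @^-1` [set k]) = (N.+1%:R^-1)%:E.
Proof.
have NE : N.+1%:R * N.+1%:R^-1 = 1 :> R by rewrite divff.
have N0 : 0 < N.+1%:R :> R by [].
rewrite /uniform_prob integral_uniform_pdf.
(* The last cell also contains the point 1, so the right bound is open exactly when [k < N]. *)
have -> : @cell R N @^-1` [set k] `&` `[0, 1] =
    [set` Interval (BLeft (k%:R / N.+1%:R : R)) (BSide (k < N)%N (k.+1%:R / N.+1%:R))].
  apply/seteqP; split => x /=.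
    move=> [ck]; rewrite in_itv /= => /andP[x0 x1].
    rewrite in_itv /= ler_pdivrMr // mulrC -ck cell_le_mul //=.
    case: ltnP => kN /=.
      by rewrite ltr_pdivlMr // mulrC ltNge -cell_gt // ltnn.
    by rewrite ler_pdivlMr // mulrC mul_le_cell.
  rewrite in_itv /= => /andP[kx xk].
  have x0 : 0 <= x by apply: le_trans kx; rewrite divr_ge0.
  have x1 : x <= 1.
    have : x <= k.+1%:R / N.+1%:R by move: xk; case: (k < N)%N => //= /ltW.
    by move/le_trans; apply; rewrite ler_pdivrMr // mul1r ler_nat ltn_ord.
  split; last by rewrite in_itv /= x0.
  apply/val_inj/eqP; rewrite eqn_leq /=; apply/andP; split.
    move: xk; case: ltnP => kN /=; last by move=> _; rewrite (leq_trans _ kN) // -ltnS.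
    by move=> xk; rewrite leqNgt cell_gt // -ltNge mulrC -ltr_pdivlMr.
  case E: (nat_of_ord k) => [//|j]; rewrite cell_gt.
    by rewrite mulrC -ler_pdivrMr // -E.
  by rewrite -ltnS -E ltn_ord.
rewrite (eq_integral (cst 1%:E)); last first.
  move=> x; rewrite inE /= in_itv /= => /andP[kx xk].
  rewrite /uniform_pdf subr0 invr1 ifT //; apply/andP; split.
    by apply: le_trans kx; rewrite divr_ge0.
  have : x <= k.+1%:R / N.+1%:R by move: xk; case: (k < N)%N => //= /ltW.
  by move/le_trans; apply; rewrite ler_pdivrMr // mul1r ler_nat ltn_ord.
rewrite integral_cst //= mul1e lebesgue_measure_itv /= lte_fin ltr_pM2r ?invr_gt0 //.
rewrite ltr_nat ltnSn -EFinB; congr EFin.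
by rewrite -mulrBl -natr1 addrAC subrr add0r mul1r.
Qed.

End CellLaw.

Section Locations.
Context (d : measure_display) (T : measurableType d) (R : realType).
Variables (P : probability T R) (n N : nat) (s t : 'I_n -> {RV P >-> R}).
Hypothesis st : iid_uniform_locations s t.

Let X (v : 'I_n + 'I_n) : {RV P >-> R} :=
  match v with inl i => s i | inr j => t j end.

Definition random_cells (w : T) : {ffun 'I_n + 'I_n -> 'I_N.+1} :=
  location_cells N (fun i => s i w) (fun j => t j w).

Lemma random_cells_preimage c : random_cells @^-1` [set c] =
  \bigcap_(v in [set` [set: 'I_n + 'I_n]%SET]) (X v @^-1` (@cell R N @^-1` [set c v])).
Proof.
apply/seteqP; split => [w <- v _ /=|w cw].
  by rewrite ffunE; case: v.
apply/ffunP => v; rewrite ffunE.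
by have := cw v; rewrite /= inE => /(_ isT); case: v.
Qed.

Lemma measurable_random_cells c : measurable (random_cells @^-1` [set c]).
Proof.
rewrite random_cells_preimage; apply: fin_bigcap_measurable => // v _.
rewrite -[_ @^-1` _]setTI; apply: measurable_funP => //.
exact: measurable_cell.
Qed.

(** The preimage of each assignment is a box, so joint independence gives every assignment the same
    mass [(N + 1) ^ (- 2 n)]. *)
Lemma expectation_random_cells (f : {ffun 'I_n + 'I_n -> 'I_N.+1} -> R) :
  (forall c, 0 <= f c) -> ('E_P[f \o random_cells] = (uniform_mean f)%:E)%E.
Proof.
move=> f0; rewrite (expectation_finite_range P measurable_random_cells f0).
rewrite /uniform_mean mulr_suml -sumEFin; apply: eq_bigr => c _.
rewrite EFinM; congr (_ * _)%E; rewrite random_cells_preimage.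
have [ind unif] := st.
rewrite (ind [set: 'I_n + 'I_n]%SET (fun v => @cell R N @^-1` [set c v])); last first.
  by move=> v _; exact: measurable_cell.
transitivity (\prod_(v in [set: 'I_n + 'I_n]%SET) (N.+1%:R^-1 : R)%:E)%E.
  apply: eq_bigr => v _; rewrite -(uniform_cell _ (c v)).
  by rewrite -(unif v) //; exact: measurable_cell.
rewrite prodEFin prodr_const cardsT card_ffun card_ord; congr EFin.
by rewrite natrX exprVn.
Qed.

End Locations.

(** * Two-sided bounds on the expected matching size *)

Section ExpectedMatching.
Context (d : measure_display) (T : measurableType d) (R : realType).
Variables (P : probability T R) (n : nat) (s t : 'I_n -> {RV P >-> R}).

(** The size factors through the adjacency matrix, which takes finitely many values and whose
    entries are measurable events. *)
Lemma measurable_matching_size (r b : R) (F : {set 'I_n}) :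
  measurable_fun setT (fun w => (max_matching_size
    (service_graph r b F (fun i => s i w) (fun j => t j w)))%:R : R).
Proof.
pose h w : {ffun 'I_n * 'I_n -> bool} :=
  [ffun e => service_graph r b F (fun i => s i w) (fun j => t j w) e.1 e.2].
pose f (v : {ffun 'I_n * 'I_n -> bool}) : R :=
  (max_matching_size (fun i j => v (i, j)))%:R.
rewrite (_ : (fun _ => _) = f \o h); last first.
  apply/funext => w /=; rewrite /f; congr (max_matching_size _)%:R.
  by apply/funext => i; apply/funext => j; rewrite ffunE.
apply: measurable_finite_range => v.
have -> : h @^-1` [set v] = \bigcap_(e in [set: 'I_n * 'I_n])
    [set w | service_graph r b F (fun i => s i w) (fun j => t j w) e.1 e.2 = v e].
  apply/seteqP; split => [w /= <- e _|w vw]; first by rewrite /= ffunE.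
  by apply/ffunP => e; rewrite ffunE; exact: vw.
apply: fin_bigcap_measurable; first exact: finite_finset.
move=> [i j] _ /=.
have m1 : measurable [set w | service_graph r b F (fun i => s i w) (fun j => t j w) i j].
  pose g w := `|s i w - t j w|.
  have mg : measurable_fun setT g by apply: measurableT_comp => //; exact: measurable_funB.
  rewrite (_ : [set _ | _] = g @^-1` `]-oo, service_range r b F i / n%:R]).
    by rewrite -[_ @^-1` _]setTI; apply: mg => //; exact: measurable_itv.
  by apply/seteqP; split => w; rewrite /= in_itv.
case: (v (i, j)) => //.
rewrite (_ : [set _ | _] = ~` [set w |
  service_graph r b F (fun i => s i w) (fun j => t j w) i j]); first exact: measurableC.
by apply/seteqP; split => w /=; [move=> ->|move/negP/negbTE].
Qed.

Hypothesis st : iid_uniform_locations s t.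

Let X (v : 'I_n + 'I_n) : {RV P >-> R} :=
  match v with inl i => s i | inr j => t j end.

(** For the lower bound: points clamped into an extreme cell could be far apart. *)
Lemma ae_locations01 : {ae P, forall w, forall v, 0 <= X v w <= 1}.
Proof.
apply: filter_forall => v.
have m01 : measurable (X v @^-1` ~` `[0, 1]).
  by rewrite -[_ @^-1` _]setTI; apply: measurable_funP => //; exact: measurableC.
suff : P.-negligible (X v @^-1` ~` `[0, 1]).
  apply: negligibleS => w /= nw; rewrite in_itv; exact: nw.
apply/negligibleP => //; have [_ unif] := st.
rewrite -[LHS]/(distribution P (X v) (~` `[0, 1])) (unif v) //; last exact: measurableC.
rewrite (@probability_setC _ _ _ (uniform_prob (@ltr01 R))) //.
rewrite [X in (_ - X)%E](_ : _ = 1%E) ?subee //.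
exact: integral_uniform_pdf1.
Qed.

Variables (m N : nat) (a : R) (F : {set 'I_n}).
Hypotheses (n0 : (0 < n)%N) (m0 : (0 < m)%N) (Nnm : N.+1 = (n * m)%N).

Let scale : N.+1%:R * (a / n%:R) = m%:R * a.
Proof. by rewrite Nnm natrM; field; rewrite pnatr_eq0 -lt0n. Qed.

Let cells_mean L : R := uniform_mean (fun c : {ffun 'I_n + 'I_n -> 'I_N.+1} =>
  (cell_matching L (supply_cells F c) (demand_cells c))%:R).

Lemma expected_matching_ge (L : nat) : L.+1%:R <= m%:R * a ->
  ((cells_mean L)%:E <= expected_matching_size s t 0%R a F)%E.
Proof.
move=> La; rewrite /cells_mean -(expectation_random_cells st); last by [].
apply: expectation_le => //.
- exact: measurable_finite_range (measurable_random_cells (N := N) s t) _.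
- exact: measurable_matching_size.
- apply: filterS ae_locations01 => w w01; rewrite ler_nat.
  apply: cells_le_matching => //.
  + by move=> i; exact: (w01 (inl i)).
  + by move=> j; exact: (w01 (inr j)).
  + by rewrite scale.
Qed.

(** The collisions contribute [(2 n) ^ 2 / (n m) = 4 n / m]. *)
Lemma expected_matching_le :
  (expected_matching_size s t 0%R a F <=
   (cells_mean (Num.truncn (m%:R * a)).+1 + 4 * n%:R / m%:R)%:E)%E.
Proof.
apply: (@le_trans _ _ (uniform_mean (fun c : {ffun 'I_n + 'I_n -> 'I_N.+1} =>
  (cell_matching (Num.truncn (m%:R * a)).+1 (supply_cells F c) (demand_cells c))%:R +
  #|collisions c|%:R))%:E).
  rewrite -(expectation_random_cells st); last by move=> c; rewrite addr_ge0.
  apply: expectation_le => //.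
  - exact: measurable_matching_size.
  - exact: measurable_finite_range (measurable_random_cells (N := N) s t) _.
  - by move=> w; rewrite addr_ge0.
  - apply: nearW => w; rewrite /= -natrD ler_nat -scale.
    exact: matching_le_cells.
rewrite uniform_meanD lee_fin lerD2l.
apply: (le_trans (uniform_mean_collisions _ _ _)).
rewrite Nnm natrM natrD (_ : _ / _ = 4 * n%:R / m%:R) //.
by field; rewrite !pnatr_eq0 -!lt0n n0 m0.
Qed.

End ExpectedMatching.

(** * The limit *)

Section LimitRate.
Variable R : realType.
Implicit Types (p a : R).

(* [S] is the integral of [exp (- (1 - p) w)] over [0, 2 a]. *)
Definition limit_rate p a : R :=
  let E := expR (- ((1 - p) * (2 * a))) in
  let S := if p == 1 then 2 * a else (1 - E) / (1 - p) in
  p * S / (E + S).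

Lemma limit_rate_lt1 p b : 0 < p < 1 -> 0 <= b ->
  limit_rate p b = (expR (2 * p * b) - expR (2 * b)) /
                   (expR (2 * p * b) - p^-1 * expR (2 * b)).
Proof.
move=> /andP[p0 p1] b0; rewrite /limit_rate lt_eqF //.
have -> : - ((1 - p) * (2 * b)) = 2 * p * b - 2 * b by ring.
rewrite expRD expRN.
have B0 : 0 < expR (2 * b) by exact: expR_gt0.
have AB : expR (2 * p * b) <= expR (2 * b).
  by rewrite ler_expR ler_wpM2r // ler_piMr // ltW.
have A0 : 0 < expR (2 * p * b) by exact: expR_gt0.
move: B0 A0 AB; move: (expR _) (expR _) => A B B0 A0 AB.
(* The denominators do not vanish because [p exp (2 p b) < exp (2 p b) <= exp (2 b)]. *)
have h : p * A - B < 0.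
  by rewrite subr_lt0 (lt_le_trans _ AB) // gtr_pMl.
have h' : A * (1 - p) + (B - A) != 0.
  rewrite (_ : _ + _ = - (p * A - B)); last by ring.
  by rewrite oppr_eq0 lt_eqF.
have h'' : A * p - B != 0 by rewrite mulrC lt_eqF.
by field; rewrite h' h'' (gt_eqF p0) (gt_eqF B0) subr_eq0 (gt_eqF p1).
Qed.

Lemma limit_rate1 a : 0 <= a -> limit_rate 1 a = a / (a + 2^-1).
Proof.
move=> a0; rewrite /limit_rate eqxx subrr mul0r oppr0 expR0.
by field; do ?[apply/andP; split]; apply: lt0r_neq0; lra.
Qed.

Lemma limit_rate0 p : limit_rate p 0 = 0.
Proof.
rewrite /limit_rate !mulr0 oppr0 expR0 subrr mul0r.
by case: ifP => _; rewrite mulr0 mul0r.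
Qed.

Lemma cvg_natV : (m%:R^-1 : R) @[m --> \oo] --> (0 : R).
Proof.
apply/cvgrPdist_lt => e e0; near=> m.
have m0 : 0 < m%:R :> R by near: m; exact: nbhs_infty_gtr.
rewrite sub0r normrN gtr0_norm ?invr_gt0 // -[ltRHS]invrK ltf_pV2 ?posrE ?invr_gt0 //.
by near: m; exact: nbhs_infty_gtr.
Unshelve. all: by end_near. Qed.

(** * The match rate as the grid is refined *)

Section RateCvg.
Variables (p a : R) (l : nat -> nat).
Hypotheses (p01 : 0 < p <= 1) (la : (l m)%:R / m%:R @[m --> \oo] --> a).

Let rho m : R := (1 - m%:R^-1) / (1 - p / m%:R).

Let natV_bound m : (2 <= m)%N -> 0 < (m%:R^-1 : R) <= 2^-1.
Proof.
move=> m2; rewrite invr_gt0 ltr0n (leq_trans _ m2) //= lef_pV2 ?posrE //.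
  by rewrite ler_nat.
by rewrite ltr0n (leq_trans _ m2).
Qed.

(** The values [c = 1] and [c = p] are the lower and upper sides of the squeeze for the power of
    [rho]. *)
Lemma cvg_discount (c : R) :
  expR (- ((1 - p) * (2 * ((l m)%:R / m%:R)) / (1 - c * m%:R^-1))) @[m --> \oo] -->
  expR (- ((1 - p) * (2 * a))).
Proof.
apply: (@continuous_cvg _ _ _ _ _ _ expR); first exact: continuous_expR.
apply: cvgN; rewrite -[X in _ --> X]divr1.
apply: cvgM; first by do 2 (apply: cvgM; first exact: cvg_cst).
apply: cvgV; first exact: oner_neq0.
rewrite -[X in _ --> X]subr0; apply: cvgB; first exact: cvg_cst.
rewrite -(mulr0 c); apply: cvgM; first exact: cvg_cst.
exact: cvg_natV.
Qed.

(** With [u = 1 / m], the inequality [1 + x <= exp x] is applied to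
    [rho = 1 - (1 - p) u / (1 - p u)] for the upper bound and to [1 / rho = 1 + (1 - p) u / (1 - u)]
    for the lower one. *)
Lemma cvg_rho_pow : rho m ^+ (l m).*2 @[m --> \oo] --> expR (- ((1 - p) * (2 * a))).
Proof.
move: p01 => /andP[p0 p1].
apply: squeeze_cvgr (cvg_discount 1) (cvg_discount p).
near=> m.
have /andP[u0 u2] : 0 < (m%:R^-1 : R) <= 2^-1 by apply: natV_bound; near: m; exact: nbhs_infty_ge.
rewrite /rho; move: u0 u2; set u := (m%:R^-1 : R) => u0 u2.
have pu : p * u <= u by rewrite ler_piMl // ltW.
have pu0 : 0 < p * u by rewrite mulr_gt0.
have d1 : 0 < 1 - u by lra.
have d2 : 0 < 1 - p * u by lra.
have kE c : - ((1 - p) * (2 * ((l m)%:R * u)) / c) = (l m).*2%:R * (- ((1 - p) * u / c)).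
  by rewrite -mul2n natrM; ring.
have rE : (1 - u) / (1 - p * u) = 1 + - ((1 - p) * u / (1 - p * u)).
  by field; rewrite gt_eqF.
have r0 : 0 < (1 - u) / (1 - p * u) by rewrite divr_gt0.
rewrite mul1r !kE !expRM_natl; apply/andP; split; apply: lerXn2r;
  rewrite ?nnegrE ?expR_ge0 ?(ltW r0) //; last by rewrite rE expR_ge1Dx.
rewrite expRN -[leRHS]invrK lef_pV2 ?posrE ?expR_gt0 ?invr_gt0 //.
apply: le_trans (expR_ge1Dx _).
rewrite (_ : _^-1 = 1 + (1 - p) * u / (1 - u)) //.
by field; rewrite !gt_eqF.
Unshelve. all: by end_near. Qed.

Let sigma := if p == 1 then 2 * a else (1 - expR (- ((1 - p) * (2 * a)))) / (1 - p).

(** For [p = 1] all [2 l] terms are 1. Otherwise the geometric sum formula applies, with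
    [1 - rho = ((1 - p) / m) / (1 - p / m)]. *)
Lemma cvg_rho_sum : m%:R^-1 * geom_sum (rho m) (l m).*2 @[m --> \oo] --> sigma.
Proof.
move: p01 => /andP[p0 p1]; rewrite /sigma; case: eqP => [pE|/eqP pN1].
  have : 2 * ((l m)%:R / m%:R) @[m --> \oo] --> 2 * a by apply: cvgM => //; exact: cvg_cst.
  apply: cvg_trans; apply: near_eq_cvg; near=> m.
  have /andP[u0 u2] : 0 < (m%:R^-1 : R) <= 2^-1 by apply: natV_bound; near: m; exact: nbhs_infty_ge.
  have -> : rho m = 1 by rewrite /rho pE mul1r divff // gt_eqF //; lra.
  rewrite /geom_sum; under eq_bigr do rewrite expr1n.
  by rewrite sumr_const card_ord -mul2n natrM; ring.
have : (1 - rho m ^+ (l m).*2) * (1 - p * m%:R^-1) / (1 - p) @[m --> \oo] -->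
    (1 - expR (- ((1 - p) * (2 * a)))) * (1 - p * 0) / (1 - p).
  apply: cvgM; last exact: cvg_cst.
  apply: cvgM; apply: cvgB; try exact: cvg_cst; first exact: cvg_rho_pow.
  by apply: cvgM; [exact: cvg_cst|exact: cvg_natV].
rewrite mulr0 subr0 mulr1; apply: cvg_trans; apply: near_eq_cvg; near=> m.
have /andP[u0 u2] : 0 < (m%:R^-1 : R) <= 2^-1 by apply: natV_bound; near: m; exact: nbhs_infty_ge.
have pu : p * m%:R^-1 <= m%:R^-1 by rewrite ler_piMl // ltW.
have p1' : 1 - p != 0 by rewrite subr_eq0 eq_sym.
have := subrX1 (rho m) (l m).*2; rewrite -/(geom_sum _ _) => e.
have -> : 1 - rho m ^+ (l m).*2 = (1 - rho m) * geom_sum (rho m) (l m).*2.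
  by rewrite -[LHS]opprB e -mulNr opprB.
move: u0 u2 pu; rewrite /rho; set u := (m%:R^-1 : R) => u0 u2 pu.
have d2 : 0 < 1 - p * u by lra.
by field; rewrite p1' gt_eqF.
Unshelve. all: by end_near. Qed.

Lemma cvg_match_rate :
  m%:R * match_rate (p / m%:R) (m%:R^-1) (l m) @[m --> \oo] --> limit_rate p a.
Proof.
move: p01 => /andP[p0 p1].
set E := expR (- ((1 - p) * (2 * a))).
have a0 : 0 <= a.
  by apply: cvgr_to_ge la _; apply: nearW => m; rewrite divr_ge0.
have E0 : 0 < E by exact: expR_gt0.
have S0 : 0 <= sigma.
  rewrite /sigma; case: eqP => [_|/eqP pN1]; first by rewrite mulr_ge0.
  have p1' : p < 1 by rewrite lt_neqAle pN1.
  rewrite divr_ge0 ?subr_ge0 ?(ltW p1') // -[leRHS]expR0 ler_expR oppr_le0.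
  by rewrite mulr_ge0 ?subr_ge0 ?mulr_ge0.
(* The prefactor [m * al * be = p / m] is distributed over the numerator, where [rho ^ (2 l) / m]
   vanishes in the limit. *)
have : p * (rho m ^+ (l m).*2 * m%:R^-1 + m%:R^-1 * geom_sum (rho m) (l m).*2) /
    (rho m ^+ (l m).*2 + m%:R^-1 * geom_sum (rho m) (l m).*2) @[m --> \oo] -->
    p * (E * 0 + sigma) / (E + sigma).
  apply: cvgM.
    apply: cvgM; first exact: cvg_cst.
    apply: cvgD; last exact: cvg_rho_sum.
    by apply: cvgM; [exact: cvg_rho_pow|exact: cvg_natV].
  apply: cvgV; first by rewrite gt_eqF // ltr_wpDr.
  by apply: cvgD; [exact: cvg_rho_pow|exact: cvg_rho_sum].
rewrite mulr0 add0r -/(limit_rate p a); apply: cvg_trans.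
apply: near_eq_cvg; near=> m.
have m0 : (m%:R : R) != 0.
  by rewrite pnatr_eq0 -lt0n; near: m; exact: nbhs_infty_ge.
rewrite /match_rate -/(rho m); move: (rho m ^+ _) (geom_sum _ _) => r g.
rewrite mulrA; congr (_ / _).
by field.
Unshelve. all: by end_near. Qed.

End RateCvg.

Lemma cvg_trunc_up a : 0 <= a ->
  ((Num.truncn (m%:R * a)).+1%:R / m%:R : R) @[m --> \oo] --> a.
Proof.
move=> a0; have : a + m%:R^-1 @[m --> \oo] --> a + 0.
  by apply: cvgD; [exact: cvg_cst|exact: cvg_natV].
rewrite addr0; apply: squeeze_cvgr; last exact: cvg_cst.
near=> m; have m0 : (0 : R) < m%:R by near: m; exact: nbhs_infty_gtr.
have /andP[h1 h2] := truncn_itv (mulr_ge0 (ltW m0) a0).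
rewrite ler_pdivlMr // ler_pdivrMr // mulrDl mulVf ?gt_eqF // -natr1.
by move: h2; rewrite -natr1 => h2; apply/andP; split; lra.
Unshelve. all: by end_near. Qed.

(** The lower bound requires [L + 1 <= m a], hence the predecessor; truncation and predecessor
    together lose at most [2 / m]. *)
Lemma cvg_trunc_down a : 0 <= a ->
  ((Num.truncn (m%:R * a)).-1%:R / m%:R : R) @[m --> \oo] --> a.
Proof.
move=> a0; have : a - 2 * m%:R^-1 @[m --> \oo] --> a - 2 * 0.
  by apply: cvgB; [exact: cvg_cst|apply: cvgM; [exact: cvg_cst|exact: cvg_natV]].
rewrite mulr0 subr0 => h; apply: squeeze_cvgr h _; last exact: cvg_cst.
near=> m; have m0 : (0 : R) < m%:R by near: m; exact: nbhs_infty_gtr.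
have /andP[h1 h2] := truncn_itv (mulr_ge0 (ltW m0) a0).
rewrite ler_pdivlMr // ler_pdivrMr // mulrBl -mulrA mulVf ?gt_eqF // mulr1.
move: h1 h2; case: (Num.truncn _) => [|k] /= h1 h2.
  by rewrite mulr_ge0 ?(ltW m0) // andbT; lra.
by move: h1 h2; rewrite -!natr1 => h1 h2; apply/andP; split; lra.
Unshelve. all: by end_near. Qed.

End LimitRate.

(** For fixed [m] the errors are [O(n / m) + O(1)], so [m] is chosen from [e] first and [n] is taken
    large afterwards. The radii [lup m] and [ldn m] bracket [m a] and give the same limiting
    rate. *)
Lemma expected_matching_cvg (R : realType) (d : nat -> measure_display)
    (T : forall n : nat, measurableType (d n)) (P : forall n : nat, probability (T n) R)
    (s t : forall n : nat, 'I_n -> {RV (P n) >-> R})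
    (Hst : forall n : nat, iid_uniform_locations (s n) (t n))
    (p a : R) (F : forall n, {set 'I_n}) :
  0 < p <= 1 -> 0 <= a -> flexible_fraction p F ->
  ((n%:R^-1)%:E * expected_matching_size (s n) (t n) 0%R a (F n))%E @[n --> \oo] -->
  (limit_rate p a)%:E.
Proof.
move=> p01 a0 Fp.
pose lup m := (Num.truncn (m%:R * a)).+1.
pose ldn m := (Num.truncn (m%:R * a)).-1.
pose rate l m := m%:R * match_rate (p / m%:R) (m%:R^-1) (l m).
pose y n := fine (expected_matching_size (s n) (t n) 0%R a (F n)).
have nu0 n : (0 <= expected_matching_size (s n) (t n) 0%R a (F n))%E.
  exact: expectation_ge0.
(* The expectation is finite, by the upper bound on any grid. *)
have yE n m : (0 < n)%N -> (0 < m)%N ->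
    expected_matching_size (s n) (t n) 0%R a (F n) = (y n)%:E.
  move=> n0 m0; rewrite /y fineK // ge0_fin_numE //.
  have Nnm : (n * m).-1.+1 = (n * m)%N by rewrite prednK // muln_gt0 n0.
  exact: le_lt_trans (expected_matching_le (Hst n) a (F n) n0 m0 Nnm) (ltry _).
rewrite (_ : (fun n => _) = (fun n => (n%:R^-1 * y n)%:E)); last first.
  (* At [n = 0] the convention [0^-1 = 0] makes both sides 0. *)
  apply/funext => -[|n]; first by rewrite invr0 mul0e mul0r.
  by rewrite (yE _ 1%N) // EFinM.
apply: cvg_EFin; first exact: nearW.
apply/cvgrPdist_le => e e0.
have e4 : 0 < e / 4 by rewrite divr_gt0.
(* [13 = 9 + 4]: the comparison with Bernoulli cells plus the collisions in the upper bound. *)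
have [m [m2 mup mdn me ma]] : exists m, [/\ (1 < m)%N,
    `|limit_rate p a - rate lup m| <= e / 4, `|limit_rate p a - rate ldn m| <= e / 4,
    13 / m%:R <= e / 4 & a = 0 \/ 1 <= m%:R * a].
  apply: (@filter_ex _ \oo); near=> m; split.
  - by near: m; exact: nbhs_infty_ge.
  - near: m; move: e4; move: (e / 4).
    exact/(cvgrPdist_le _ _).1/(cvg_match_rate p01 (cvg_trunc_up a0)).
  - near: m; move: e4; move: (e / 4).
    exact/(cvgrPdist_le _ _).1/(cvg_match_rate p01 (cvg_trunc_down a0)).
  - have m0 : 0 < m%:R :> R by near: m; exact: nbhs_infty_gtr.
    rewrite ler_pdivrMr // mulrC -ler_pdivrMr //.
    by near: m; exact: nbhs_infty_ger.
  - have := a0; rewrite le_eqVlt => /orP[/eqP <-|a0']; [by left|right].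
    by rewrite -ler_pdivrMr //; near: m; exact: nbhs_infty_ger.
have [K1 HK1] := uniform_cell_matching_rate (lup m) p01 m2.
have [K2 HK2] := uniform_cell_matching_rate (ldn m) p01 m2.
near=> n.
have n0 : (0 < n)%N by near: n; exact: nbhs_infty_ge.
have n0' : 0 < n%:R :> R by rewrite ltr0n.
have m0 : (0 < m)%N by rewrite ltnW.
have m0' : 0 < m%:R :> R by rewrite ltr0n.
have K1n : `|K1| / n%:R <= e / 4.
  rewrite ler_pdivrMr // mulrC -ler_pdivrMr //.
  by near: n; exact: nbhs_infty_ger.
have K2n : `|K2| / n%:R <= e / 4.
  rewrite ler_pdivrMr // mulrC -ler_pdivrMr //.
  by near: n; exact: nbhs_infty_ger.
have Nnm : (n * m).-1.+1 = (n * m)%N by rewrite prednK // muln_gt0 n0.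
have B1 := HK1 n _ (F n) n0 Nnm (Fp n).
have B2 := HK2 n _ (F n) n0 Nnm (Fp n).
have up := expected_matching_le (Hst n) a (F n) n0 m0 Nnm.
rewrite (yE n m) // lee_fin in up.
have yup : n%:R^-1 * y n <= rate lup m + 13 / m%:R + `|K1| / n%:R.
  rewrite mulrC ler_pdivrMr // (_ : _ * _ =
    n%:R * rate lup m + 13 * (n%:R / m%:R) + `|K1|); last first.
    by field; rewrite !gt_eqF.
  move: B1; rewrite ler_norml => /andP[_ B1]; move: up B1 (ler_norm K1); rewrite /rate.
  rewrite -[9 * _ / _]mulrA -[4 * _ / _]mulrA.
  move: (uniform_mean _) (n%:R * (m%:R * _)) (n%:R / m%:R) => U r q; lra.
have ydn : limit_rate p a - e <= n%:R^-1 * y n.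
  have y0 : 0 <= n%:R^-1 * y n by rewrite mulr_ge0 ?invr_ge0 ?(ltW n0') // fine_ge0.
  (* At [a = 0] no radius satisfies [L + 1 <= m a], but the limit is 0 and nonnegativity
     suffices. *)
  case: ma => [aE|ma].
    by rewrite aE limit_rate0 sub0r (le_trans _ y0) // oppr_le0 ltW.
  have tr0 : (0 < Num.truncn (m%:R * a))%N by rewrite truncn_gt0.
  have La : (ldn m).+1%:R <= m%:R * a.
    by rewrite /ldn prednK // truncn_le mulr_ge0 // ltW.
  have dn := expected_matching_ge (Hst n) (F n) n0 Nnm La.
  rewrite (yE n m) // lee_fin in dn.
  have : rate ldn m - 9 / m%:R - `|K2| / n%:R <= n%:R^-1 * y n.
    rewrite [leRHS]mulrC ler_pdivlMr // (_ : _ * _ =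
      n%:R * rate ldn m - 9 * (n%:R / m%:R) - `|K2|); last first.
      by field; rewrite !gt_eqF.
    move: B2; rewrite ler_norml => /andP[B2 _]; move: dn B2 (ler_norm K2); rewrite /rate.
    rewrite -[9 * _ / _]mulrA.
    move: (uniform_mean _) (n%:R * (m%:R * _)) (n%:R / m%:R) => U r q; lra.
  have : 9 / m%:R <= 13 / m%:R :> R by rewrite ler_pM2r ?invr_gt0 // ler_nat.
  by move: mdn; rewrite ler_norml => /andP[? ?]; lra.
rewrite /= ler_norml; move: mup; rewrite ler_norml => /andP[? ?].
by apply/andP; split; lra.
Unshelve. all: by end_near. Qed.

Local Open Scope ring_scope.

Theorem theorem3 (R : realType)
    (d : nat -> measure_display) (T : forall n : nat, measurableType (d n))
    (P : forall n : nat, probability (T n) R)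
    (s t : forall n : nat, 'I_n -> {RV (P n) >-> R})
    (Hst : forall n : nat, iid_uniform_locations (s n) (t n)) :
  let nu (n : nat) (r b : R) (F : forall n : nat, {set 'I_n}) :=
    expected_matching_size (s n) (t n) r b (F n) in
  (forall (b p : R) (F : forall n : nat, {set 'I_n}),
     0 <= b -> 0 < p < 1 -> flexible_fraction p F ->
     ((n%:R^-1)%:E * nu n 0%R b F)%E @[n --> \oo] -->
       ((expR (2 * p * b) - expR (2 * b))
        / (expR (2 * p * b) - p^-1 * expR (2 * b)))%:E)
  /\
  (forall (r p : R) (F : forall n : nat, {set 'I_n}),
     0 <= r -> 0 <= p <= 1 -> flexible_fraction p F ->
     ((n%:R^-1)%:E * nu n r 0%R F)%E @[n --> \oo] --> (r / (r + 2^-1))%:E)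
  /\
  (forall (r b : R) (F : forall n : nat, {set 'I_n}),
     0 <= r -> 0 <= b -> flexible_fraction (0 : R) F ->
     ((n%:R^-1)%:E * nu n r b F)%E @[n --> \oo] --> (r / (r + 2^-1))%:E).
Proof.
(* In both cases of (ii) every supplier has range [r / n]: this is the model with base range 0,
   bonus [r] and all suppliers flexible, that is [p = 1]. *)
have same_range (n : nat) (r b : R) (F : {set 'I_n}) : b = 0 \/ F = finset.set0 ->
    service_graph r b F = service_graph 0 r [set: 'I_n]%SET.
  move=> h; apply/funext => x; apply/funext => y; apply/funext => i; apply/funext => j.
  rewrite /service_graph /service_range !inE add0r.
  by case: h => ->; rewrite ?addr0 ?inE // if_same.
have full1 : flexible_fraction (1 : R) (fun n => [set: 'I_n]%SET).
  by move=> n; rewrite cardsT card_ord mul1r subrr normr0.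
have cvg1 (r : R) (r0 : 0 <= r) :
    ((n%:R^-1)%:E * expected_matching_size (s n) (t n) 0%R r [set: 'I_n]%SET)%E
      @[n --> \oo] --> (r / (r + 2^-1))%:E.
  rewrite -limit_rate1 //; apply: (expected_matching_cvg Hst _ r0 full1).
  by rewrite ltr01 lexx.
split; [|split].
- move=> b p F b0 p01 Fp; rewrite -limit_rate_lt1 //.
  apply: (expected_matching_cvg Hst _ b0 Fp).
  by case/andP: p01 => -> /ltW.
- move=> r p F r0 _ _.
  rewrite (_ : (fun n => _) = fun n : nat => ((n%:R^-1)%:E *
    expected_matching_size (s n) (t n) 0%R r [set: 'I_n]%SET)%E); first exact: cvg1.
  apply/funext => n; congr (_ * _)%E.
  by rewrite /expected_matching_size same_range //; left.
- move=> r b F r0 _ F0.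
  rewrite (_ : (fun n => _) = fun n : nat => ((n%:R^-1)%:E *
    expected_matching_size (s n) (t n) 0%R r [set: 'I_n]%SET)%E); first exact: cvg1.
  apply/funext => n; congr (_ * _)%E.
  rewrite /expected_matching_size same_range //; right.
  (* For [p = 0] the rounding condition reads [#|F n| < 1], so [F n] is empty. *)
  have := F0 n; rewrite mul0r subr0 ger0_norm // (ltr_nat R _ 1) ltnS leqn0 cards_eq0.
  by move/eqP.
Qed.
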